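(* Consider the following problem (SCO). Let $f\colon\mathbb{R}^d\to\mathbb{R}$ be a differentiable convex function that is $L$-Lipschitz with respect to the Euclidean norm and has a minimizer $x^\star\in\operatorname{argmin}_{x\in\mathbb{R}^d}f(x)$ with $\|x^\star\|\le R$; given access to a stochastic gradient oracle for $f$ and a target accuracy $\epsilon>0$, output an $\epsilon$-optimal point of $f$. For every $\sigma_V>0$, this problem can be solved with probability at least $2/3$ using $\tilde O\left(dR^2\sigma_V^2/\epsilon^2+d\right)$ queries to a $\sigma_V$-VSGO for $f$.
   Context: $\|\cdot\|$ is the Euclidean norm. A point $x$ is $\epsilon$-optimal if $f(x)\le \inf_y f(y)+\epsilon$. A stochastic gradient oracle (SGO) for differentiable $f$ is an oracle $\mathcal{O}$ which, when queried at $x\in\mathbb{R}^d$, outputs a random vector $\mathcal{O}(x)\in\mathbb{R}^d$ with $\mathbb{E}\,\mathcal{O}(x)=\nabla f(x)$; the randomness of each call is independent of previous calls. A $\sigma_V$-variance-bounded SGO ($\sigma_V$-VSGO) is an SGO $\mathcal{O}_V$ for $f$ such that $\mathbb{E}\|\mathcal{O}_V(x)-\nabla f(x)\|^2\le\sigma_V^2$ for every $x\in\mathbb{R}^d$. $\tilde O(\cdot)$ hides polylogarithmic factors in $1/\epsilon$, $d$, $R$, $L$. *)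

(* Defs.v *)
From HB Require Import structures.
From mathcomp Require Import all_boot all_order all_algebra.
From mathcomp Require Import all_classical all_reals all_analysis.
From mathcomp Require Import measurable_realfun.
Set Implicit Arguments.
Unset Strict Implicit.
Unset Printing Implicit Defensive.
Import Order.TTheory GRing.Theory Num.Theory.
Import numFieldNormedType.Exports.
Local Open Scope classical_set_scope.
Local Open Scope ring_scope.

(* The norm that the library puts on 'rV[R]_d is the sup norm; it induces the
   usual topology, so [open], [differentiable] and ['D_v f] are the usual
   notions, but norms of vectors must be taken with [enorm]. *)
Definition enorm (R : realType) (d : nat) (x : 'rV[R]_d) : R :=
  Num.sqrt (\sum_(i < d) x 0 i ^+ 2).

Definition grad (R : realType) (d : nat) (f : 'rV[R]_d -> R) (x : 'rV[R]_d) :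
  'rV[R]_d := \row_(i < d) 'D_(delta_mx 0 i) f x.

(* R^d with its Borel sigma-algebra; convertible to 'rV[R]_d. *)
Notation borel_rV R d := (g_sigma_algebraType (@open 'rV[R]_d)).

Definition eps_optimal (R : realType) (d : nat) (f : 'rV[R]_d -> R) (eps : R)
  (x : 'rV[R]_d) : Prop := f x <= inf (range f) + eps.

Definition is_minimizer (R : realType) (d : nat) (f : 'rV[R]_d -> R)
  (x : 'rV[R]_d) : Prop := forall y, f x <= f y.

Definition sco_objective (R : realType) (d : nat) (L Rad : R)
    (f : 'rV[R]_d -> R) : Prop :=
  [/\ forall x, differentiable f x,
      convex_function (E := 'rV[R]_d) setT f,
      forall x y, `|f x - f y| <= L * enorm (x - y) &
      exists xstar, is_minimizer f xstar /\ enorm xstar <= Rad].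

(* A stochastic oracle is a Markov kernel: [orc x] is the law of the answer to
   a query at [x]. *)
Definition is_SGO (R : realType) (d : nat) (f : 'rV[R]_d -> R)
    (orc : R.-pker (borel_rV R d) ~> (borel_rV R d)) : Prop :=
  forall (x : 'rV[R]_d) (i : 'I_d),
    (orc x).-integrable setT (fun y : borel_rV R d => ((y : 'rV[R]_d) 0 i)%:E) /\
    (\int[orc x]_y ((y : 'rV[R]_d) 0 i)%:E)%E = (grad f x 0 i)%:E.

Definition is_VSGO (R : realType) (d : nat) (sigma : R) (f : 'rV[R]_d -> R)
    (orc : R.-pker (borel_rV R d) ~> (borel_rV R d)) : Prop :=
  is_SGO f orc /\
  forall x : 'rV[R]_d,
    (\int[orc x]_y (enorm ((y : 'rV[R]_d) - grad f x) ^+ 2)%:E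
      <= (sigma ^+ 2)%:E)%E.

(* A randomized adaptive algorithm with oracle access.  The initial memory
   carries all of the internal randomness (for instance an infinite random
   tape), so the later updates are deterministic; since the memory space is
   arbitrary, the memory can record the number of queries made so far and the
   whole transcript. *)
Record algorithm (R : realType) (d : nat) := Algorithm {
  mem_disp : measure_display ;
  mem : measurableType mem_disp ;
  mem_init : probability mem R ;
  query : mem -> borel_rV R d ;
  update : mem * borel_rV R d -> mem ;
  output : mem -> borel_rV R d ;
  query_meas : measurable_fun setT query ;
  update_meas : measurable_fun setT update ;
  output_meas : measurable_fun setT output }.

Section step.
Context (R : realType) (d : nat) (A : algorithm R d).
Variable orc : R.-pker (borel_rV R d) ~> (borel_rV R d).
Local Open Scope ereal_scope.

Definition answer (m : mem A) : {measure set (borel_rV R d) -> \bar R} :=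
  orc (query m).

Let answer_meas (U : set (borel_rV R d)) :
  measurable U -> measurable_fun setT (answer ^~ U).
Proof.
by move=> mU; exact: (measurableT_comp (measurable_kernel orc U mU) (@query_meas R d A)).
Qed.

HB.instance Definition _ := isKernel.Build _ _ _ _ R answer answer_meas.

Let answer_prob m : answer m setT = 1.
Proof. exact: prob_kernel. Qed.

HB.instance Definition _ :=
  Kernel_isProbability.Build _ _ _ _ R answer answer_prob.

(* The law of the next memory state given the current one, [m]: the answer is
   drawn from [orc (query m)] whatever the past, so that the randomness of
   distinct oracle calls is independent. *)
Definition step (m : mem A) (U : set (mem A)) : \bar R :=
  answer m [set y | U (update (m, y))].

Let stepE m (U : set (mem A)) : measurable U ->
  step m U = (answer \; kdirac (@update_meas R d A)) m U.
Proof.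
move=> mU; rewrite /step /= /kcomp /kdirac /=.
have mp : measurable ((fun y => update (m, y)) @^-1` U).
  rewrite -[X in measurable X]setTI.
  exact: (measurableT_comp (@update_meas R d A) (measurable_pair1 m)).
by rewrite -[X in answer m X]setIT -integral_indic.
Qed.

Lemma measurable_step (U : set (mem A)) :
  measurable U -> measurable_fun setT (step ^~ U).
Proof.
move=> mU; rewrite (_ : step ^~ U = (answer \; kdirac (@update_meas R d A)) ^~ U).
  exact: measurable_kernel.
by apply/funext => m; exact: stepE.
Qed.

Lemma step_ge0 m U : 0 <= step m U.
Proof. exact: measure_ge0. Qed.

Lemma step_sigma_additive m : semi_sigma_additive (step m).
Proof.
move=> F mF tF mUF; rewrite stepE//.
rewrite [X in X @ _](_ : _ = (fun n =>
  \sum_(0 <= i < n) (answer \; kdirac (@update_meas R d A)) m (F i))).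
  exact: measure_semi_sigma_additive.
by apply/funext => n; apply: eq_bigr => i _; exact: stepE.
Qed.

Variable mu : probability (mem A) R.

Definition next_law (U : set (mem A)) : \bar R := \int[mu]_m step m U.

Let next_law0 : next_law set0 = 0.
Proof. by apply: integral0_eq => m _; rewrite /step measure0. Qed.

Let next_law_ge0 U : 0 <= next_law U.
Proof. by apply: integral_ge0 => m _; exact: measure_ge0. Qed.

Let next_law_sigma_additive : semi_sigma_additive next_law.
Proof.
move=> F mF tF mUF; rewrite [X in _ --> X](_ : _ =
    \int[mu]_m (\sum_(0 <= k <oo) step m (F k))); last first.
  by apply: eq_integral => m _; apply/esym/cvg_lim => //; exact: step_sigma_additive.
rewrite [X in X @ _](_ : _ =
    (fun n => \int[mu]_m (\sum_(0 <= i < n) step m (F i)))); last first.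
  apply/funext => n; rewrite -ge0_integral_sum//.
  by move=> i; exact: measurable_step.
apply: cvg_monotone_convergence => //.
- by move=> n; apply: emeasurable_sum => i; exact: measurable_step.
- by move=> n m _; apply: sume_ge0 => *; exact: step_ge0.
- by move=> m _ a b ab; apply: ereal_nondecreasing_series => // *; exact: step_ge0.
Qed.

HB.instance Definition _ := isMeasure.Build _ _ R next_law
  next_law0 next_law_ge0 next_law_sigma_additive.

Let next_law_setT : next_law setT = 1.
Proof.
rewrite /next_law (eq_integral (cst 1)) => [|m _].
  by rewrite integral_cst// mul1e; exact: probability_setT.
exact: answer_prob.
Qed.

HB.instance Definition _ :=
  Measure_isProbability.Build _ _ R next_law next_law_setT.

End step.

(* The law of the memory after [N] oracle queries. *)
Fixpoint mem_law (R : realType) (d : nat) (A : algorithm R d)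
    (orc : R.-pker (borel_rV R d) ~> (borel_rV R d)) (N : nat) :
    probability (mem A) R :=
  if N is n.+1 then next_law orc (mem_law A orc n) else mem_init A.

(* Main.v *)
Require Import Defs.
From HB Require Import structures.
From mathcomp Require Import all_boot all_order all_algebra.
From mathcomp Require Import all_classical all_reals all_analysis.
From mathcomp Require Import measurable_realfun.
From mathcomp Require Import ring lra zify.

(* A stochastic cutting-plane method.  The query point is the center of an
   inscribed ellipsoid of almost maximal volume of the current convex region.
   If the half of the region selected by a cut through that center still
   contained an ellipsoid of volume at least [1 - 1/2000] times as large, then
   the two ellipsoids, diagonalized simultaneously by a singular value
   decomposition, could be combined into one of volume [1 + 1/2000] times as
   large inside the old region.  Hence the maximal volume drops by a constant
   factor per cut and [O(d log)] cuts suffice.  Every point of the ball is then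
   almost cut off by some query, and a projected gradient descent driven by the
   recorded cuts turns this into weights certifying that an average of the
   query points is optimal; no function value is needed.  The descent costs no
   oracle call.

   Each cut only needs a gradient up to an error [eps / (4 Rad)], obtained by a
   median of [O(log)] means of [O(Rad^2 sigma^2 / eps^2) + 1] answers.  Answers
   are rounded to a fine grid, so that the memory of the algorithm is countable
   and every function of it is measurable. *)

Set Implicit Arguments.
Unset Strict Implicit.
Unset Printing Implicit Defensive.
Import Order.TTheory GRing.Theory Num.Theory.
Import numFieldNormedType.Exports.
Local Open Scope classical_set_scope.
Local Open Scope ring_scope.

(** * Euclidean geometry and the singular value decomposition *)

(** Volume enters only through [|\det B|] of an ellipsoid [c + u *m B], so no integration over
    convex bodies is involved. The supremum of these determinants is only approached; the slack
    [1 + gain R] allowed to a center equals the gain of the combination argument, which is what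
    makes the contradiction close. Applied to the minimizer, the covering property of the cuts
    yields one good query point, but gradients alone do not tell which one. Hence the passage from
    one cut for each [x] to one list of cuts for all [x], a minimax exchange: the average it
    certifies is good against the minimizer, wherever that lies. The factor [d] of the query count
    comes from the number of cuts. The variance bound concerns the Euclidean norm of the whole
    answer, so the length of a block of answers is free of [d], and only the number of blocks
    depends on it, logarithmically. Rounding biases the answers slightly, so second moments are
    propagated with a growth factor instead of by exact orthogonality. *)

Definition dotv (R : realType) (d : nat) (x y : 'rV[R]_d) : R :=
  \sum_(i < d) x 0 i * y 0 i.

Section InnerProduct.
Context (R : realType) (d : nat).
Implicit Types (x y z : 'rV[R]_d) (a : R).

Lemma dotvE x y : dotv x y = (x *m y^T) 0 0.
Proof. by rewrite mxE; apply: eq_bigr => i _; rewrite mxE. Qed.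

Lemma dotvC x y : dotv x y = dotv y x.
Proof. by apply: eq_bigr => i _; rewrite mulrC. Qed.

Lemma dotvDl x y z : dotv (x + y) z = dotv x z + dotv y z.
Proof. by rewrite !dotvE mulmxDl mxE. Qed.

Lemma dotvDr x y z : dotv x (y + z) = dotv x y + dotv x z.
Proof. by rewrite !(dotvC x) dotvDl. Qed.

Lemma dotvZl a x y : dotv (a *: x) y = a * dotv x y.
Proof. by rewrite !dotvE -scalemxAl mxE. Qed.

Lemma dotvZr a x y : dotv x (a *: y) = a * dotv x y.
Proof. by rewrite !(dotvC x) dotvZl. Qed.

Lemma dotvNl x y : dotv (- x) y = - dotv x y.
Proof. by rewrite -scaleN1r dotvZl mulN1r. Qed.

Lemma dotvNr x y : dotv x (- y) = - dotv x y.
Proof. by rewrite !(dotvC x) dotvNl. Qed.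

Lemma dotvBl x y z : dotv (x - y) z = dotv x z - dotv y z.
Proof. by rewrite dotvDl dotvNl. Qed.

Lemma dotvBr x y z : dotv x (y - z) = dotv x y - dotv x z.
Proof. by rewrite dotvDr dotvNr. Qed.

Lemma dot0v x : dotv 0 x = 0.
Proof. by rewrite dotvE mul0mx mxE. Qed.

Lemma dotv0 x : dotv x 0 = 0.
Proof. by rewrite dotvC dot0v. Qed.

Lemma dotv_suml (I : Type) (r : seq I) (P : pred I) (F : I -> 'rV[R]_d) x :
  dotv (\sum_(i <- r | P i) F i) x = \sum_(i <- r | P i) dotv (F i) x.
Proof.
by elim/big_rec2: _ => [|i a b _ <-]; rewrite ?dot0v// dotvDl.
Qed.

Lemma dotv_delta x i : dotv x (delta_mx 0 i) = x 0 i.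
Proof.
rewrite /dotv (bigD1 i)//= mxE !eqxx mulr1 big1 ?addr0// => j ji.
by rewrite mxE (negbTE ji) andbF mulr0.
Qed.

Lemma dotvv_ge0 x : 0 <= dotv x x.
Proof. by apply: sumr_ge0 => i _; rewrite -expr2 sqr_ge0. Qed.

Lemma enorm_sqr x : enorm x ^+ 2 = dotv x x.
Proof.
have -> : enorm x = Num.sqrt (dotv x x).
  by congr Num.sqrt; apply: eq_bigr => i _; rewrite expr2.
by rewrite sqr_sqrtr ?dotvv_ge0.
Qed.

Lemma enorm_ge0 x : 0 <= enorm x.
Proof. exact: sqrtr_ge0. Qed.

Lemma ler_enorm x a : 0 <= a -> (enorm x <= a) = (dotv x x <= a ^+ 2).
Proof. by move=> a0; rewrite -enorm_sqr ler_pXn2r// nnegrE enorm_ge0. Qed.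

Lemma dotvv_eq0 x : (dotv x x == 0) = (x == 0).
Proof.
apply/idP/eqP => [|->]; last by rewrite dot0v.
rewrite psumr_eq0 => [|i _]; last by rewrite -expr2 sqr_ge0.
move=> /allP x0; apply/rowP => i; rewrite mxE.
by have := x0 i (mem_index_enum _); rewrite /= -expr2 sqrf_eq0 => /eqP.
Qed.

Lemma enorm_eq0 x : (enorm x == 0) = (x == 0).
Proof. by rewrite -sqrf_eq0 enorm_sqr dotvv_eq0. Qed.

Lemma enorm0 : enorm (0 : 'rV[R]_d) = 0.
Proof. by apply/eqP; rewrite enorm_eq0. Qed.

Lemma enorm_gt0 x : (0 < enorm x) = (x != 0).
Proof. by rewrite lt_def enorm_ge0 andbT enorm_eq0. Qed.

Lemma enormZ a x : enorm (a *: x) = `|a| * enorm x.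
Proof.
apply/eqP; rewrite -(@eqrXn2 _ 2)// ?mulr_ge0// ?enorm_ge0//.
by rewrite exprMn !enorm_sqr dotvZl dotvZr mulrA real_normK ?num_real.
Qed.

Lemma enormN x : enorm (- x) = enorm x.
Proof. by rewrite -scaleN1r enormZ normrN1 mul1r. Qed.

Lemma cauchy_schwarz x y : dotv x y <= enorm x * enorm y.
Proof.
have [->|x0] := eqVneq x 0; first by rewrite dot0v enorm0 mul0r.
have [->|y0] := eqVneq y 0; first by rewrite dotv0 enorm0 mulr0.
have := dotvv_ge0 (enorm y *: x - enorm x *: y).
rewrite !(dotvBl, dotvBr, dotvZl, dotvZr) -!enorm_sqr (dotvC y x).
have ex : 0 < enorm x by rewrite enorm_gt0.
have ey : 0 < enorm y by rewrite enorm_gt0.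
move: (enorm x) (enorm y) (dotv x y) ex ey => p q r p0 q0 h.
have : 0 <= 2 * (p * q) * (p * q - r) by nra.
by rewrite pmulr_rge0 ?subr_ge0// mulr_gt0 ?mulr_gt0.
Qed.

Lemma cauchy_schwarz_abs x y : `|dotv x y| <= enorm x * enorm y.
Proof.
rewrite ler_norml cauchy_schwarz andbT lerNl -dotvNl.
by rewrite -(enormN x) cauchy_schwarz.
Qed.

Lemma ler_enormD x y : enorm (x + y) <= enorm x + enorm y.
Proof.
rewrite ler_enorm ?addr_ge0 ?enorm_ge0//.
rewrite dotvDl !dotvDr (dotvC y x) sqrrD !enorm_sqr.
have := cauchy_schwarz x y; lra.
Qed.

Lemma ler_enormB x y : enorm (x - y) <= enorm x + enorm y.
Proof. by rewrite (le_trans (ler_enormD _ _))// enormN. Qed.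

Lemma enormBC x y : enorm (x - y) = enorm (y - x).
Proof. by rewrite -enormN opprB. Qed.

Lemma enorm_coord x i : `|x 0 i| <= enorm x.
Proof.
rewrite -(@ler_pXn2r _ 2)// ?nnegrE ?enorm_ge0// real_normK ?num_real//.
rewrite enorm_sqr /dotv (bigD1 i)//= expr2 lerDl.
by apply: sumr_ge0 => j _; rewrite -expr2 sqr_ge0.
Qed.

End InnerProduct.

Lemma dotv_mulmx (R : realType) (m n : nat) (x : 'rV[R]_m) (y : 'rV[R]_n)
  (A : 'M[R]_(m, n)) : dotv (x *m A) y = dotv x (y *m A^T).
Proof. by rewrite !dotvE trmx_mul trmxK mulmxA. Qed.

Lemma enorm_orthogonal (R : realType) (n : nat) (x : 'rV[R]_n) (Q : 'M[R]_n) :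
  Q *m Q^T = 1%:M -> enorm (x *m Q) = enorm x.
Proof.
move=> QQ; apply/eqP; rewrite -(@eqrXn2 _ 2)// ?enorm_ge0// !enorm_sqr.
by rewrite dotv_mulmx -mulmxA QQ mulmx1.
Qed.

Lemma continuous_sum (R : realType) (d : nat) (I : Type) (r : seq I) (F : I ->
  'rV[R]_d -> R) :
  (forall i, continuous (F i)) -> continuous (fun x => \sum_(i <- r) F i x).
Proof.
move=> cF; elim: r => [|i r ih].
  have -> : (fun x => \sum_(i <- [::]) F i x) = cst 0.
    by apply/funext => x; rewrite big_nil.
  exact: cst_continuous.
have -> : (fun x => \sum_(j <- i :: r) F j x) =
    (fun x => F i x + \sum_(j <- r) F j x).
  by apply/funext => x; rewrite big_cons.
by move=> x; apply: continuousD; [exact: cF|exact: ih].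
Qed.

Lemma continuous_dotv_mulmx (R : realType) (n d : nat) (B : 'M[R]_(n, d)) :
  continuous (fun x : 'rV[R]_n => dotv (x *m B) (x *m B)).
Proof.
have cB j : continuous (fun x : 'rV[R]_n => (x *m B) 0 j).
  under eq_fun do rewrite mxE.
  apply: continuous_sum => i x.
  by apply: continuousM; [exact: coord_continuous|exact: cst_continuous].
by apply: continuous_sum => i x; apply: continuousM; exact: cB.
Qed.

Lemma compact_esphere (R : realType) (d : nat) :
  compact [set x : 'rV[R]_d | dotv x x = 1].
Proof.
apply: bounded_closed_compact.
  exists 1; split; rewrite ?num_real// => M M1 x /= x1.
  rewrite /Num.norm/= mx_normrE; apply/bigmax_leP; split;
    first by rewrite ltW// (lt_trans ltr01).
  move=> [i j] _ /=; rewrite (ord1 i) (le_trans (enorm_coord _ _))// ltW//.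
  apply: le_lt_trans M1.
  by rewrite ler_enorm// x1 expr1n.
have -> : [set x : 'rV[R]_d | dotv x x = 1] =
  (fun x => dotv (x *m 1%:M) (x *m 1%:M)) @^-1` [set 1].
  by apply/seteqP; split => x /=; rewrite mulmx1.
by apply: closed_comp; [move=> x _;
  exact: continuous_dotv_mulmx|exact: closed_eq].
Qed.

(** Compactness of the sphere gives a maximizer and homogeneity extends the bound to every [w]. The
    vector [v] is a left singular vector for the largest singular value. *)
Lemma max_gain (R : realType) (n : nat) (B : 'M[R]_n.+1) :
  exists2 v : 'rV[R]_n.+1, dotv v v = 1 &
    forall w, dotv (w *m B) (w *m B) <= dotv (v *m B) (v *m B) * dotv w w.
Proof.
have [||//|v v1 vB] := @EVT_max_rV R _ (fun x => dotv (x *m B) (x *m B))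
    [set x | dotv x x = 1].
- by exists (delta_mx 0 0) => /=; rewrite dotv_delta mxE !eqxx.
- exact: compact_esphere.
- by apply: continuous_subspaceT; exact: continuous_dotv_mulmx.
exists v; first by rewrite inE in v1.
move=> w; have [->|w0] := eqVneq w 0; first by rewrite mul0mx !dot0v mulr0.
have ew : 0 < enorm w by rewrite enorm_gt0.
have u1 : dotv ((enorm w)^-1 *: w) ((enorm w)^-1 *: w) = 1.
  by rewrite dotvZl dotvZr -enorm_sqr; field; rewrite gt_eqF.
have := vB ((enorm w)^-1 *: w); rewrite inE /= => /(_ u1).
rewrite -scalemxAl dotvZl dotvZr mulrA -invfM -expr2.
by rewrite mulrC ler_pdivrMr ?exprn_gt0// enorm_sqr.
Qed.

(** The reflection in the hyperplane orthogonal to [v - e] exchanges the unit vectors [e] and [v];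
    it extends [v] to an orthogonal matrix whose first row is [v]. *)
Lemma householder (R : realType) (n : nat) (v : 'rV[R]_n.+1) : dotv v v = 1 ->
  exists2 H : 'M[R]_n.+1, H *m H^T = 1%:M & delta_mx 0 0 *m H = v.
Proof.
move=> v1; set e : 'rV[R]_n.+1 := delta_mx 0 0.
have e1 : dotv e e = 1 by rewrite dotv_delta mxE !eqxx.
have [->|ve] := eqVneq v e.
  by exists 1%:M; rewrite ?trmx1 mulmx1.
have [z zE] : exists z, z = v - e by eexists.
have z0 : dotv z z != 0 by rewrite dotvv_eq0 zE subr_eq0.
pose H : 'M[R]_n.+1 := 1%:M - (2 / dotv z z) *: (z^T *m z).
have HT : H^T = H by rewrite /H linearB linearZ /= trmx1 trmx_mul trmxK.
have zz : z *m z^T = (dotv z z)%:M.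
  by rewrite dotvE; apply/matrixP => i j; rewrite !ord1 [RHS]mxE eqxx.
exists H.
  have AA : (z^T *m z) *m (z^T *m z) = dotv z z *: (z^T *m z).
    by rewrite mulmxA -(mulmxA z^T) zz mul_mx_scalar -scalemxAl.
  rewrite HT /H mulmxBl mul1mx mulmxBr mulmx1 -!scalemxAl -!scalemxAr AA.
  rewrite !scalerA opprB addrA; apply/matrixP => i j; rewrite !mxE.
  by set x := (\sum__ _); set y := _ %:R; field.
rewrite /H mulmxBr mulmx1 -scalemxAr mulmxA.
have -> : e *m z^T = (dotv e z)%:M.
  by rewrite dotvE; apply/matrixP => i j; rewrite !ord1 [RHS]mxE eqxx.
rewrite mul_scalar_mx scalerA.
have -> : 2 / dotv z z * dotv e z = -1.
  have : dotv z z = - 2 * dotv e z.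
    by rewrite zE !(dotvBl, dotvBr) v1 e1 (dotvC v e); ring.
  by move=> E; move: z0; rewrite E => z0; field; move: z0; lra.
by rewrite scaleN1r opprK zE addrC subrK.
Qed.

(** First-order optimality: moving from [v] to [v + t *: w] changes the squared norm only at order
    [t ^+ 2], so the image cannot change at order [t]. *)
Lemma max_gain_orthogonal (R : realType) (n : nat) (B : 'M[R]_n)
    (v w : 'rV[R]_n) :
  dotv v v = 1 ->
  (forall w, dotv (w *m B) (w *m B) <= dotv (v *m B) (v *m B) * dotv w w) ->
  dotv w v = 0 -> dotv (w *m B) (v *m B) = 0.
Proof.
move=> v1 vB wv.
have h (t : R) : 2 * t * dotv (w *m B) (v *m B) <=
    t ^+ 2 * (dotv (v *m B) (v *m B) * dotv w w).
  have := vB (v + t *: w); rewrite mulmxDl -scalemxAl.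
  rewrite !(dotvDl, dotvDr, dotvZl, dotvZr) v1 wv (dotvC v w) wv.
  rewrite (dotvC (v *m B) (w *m B)).
  have := dotvv_ge0 (w *m B).
  move: (dotv (w *m B) (w *m B)) (dotv (w *m B) (v *m B)) => p q p0.
  have := mulr_ge0 (sqr_ge0 t) p0; nra.
move: (dotv (w *m B) (v *m B)) (dotv (v *m B) (v *m B) * dotv w w) h => q c h.
have c0 : 0 <= c by move: (h 1) (h (-1)); lra.
have [//|q0] := eqVneq q 0.
(* For this [t] the left side of [h] equals [t ^+ 2 * (2 * (c + 1))], which exceeds [t ^+ 2 * c]. *)
have := h (q / (c + 1)).
have -> : 2 * (q / (c + 1)) * q = (q / (c + 1)) ^+ 2 * (2 * (c + 1)).
  by field; lra.
rewrite ler_pM2l; first lra.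
by rewrite exprn_even_gt0//= mulf_neq0// invr_neq0//; lra.
Qed.

(** Induction on the dimension. A top singular vector [v] and the direction [u] of its image become
    the first basis vectors after two reflections; by optimality of [v] the rest of the first row
    and column vanishes, and the remaining block is treated recursively. *)
Theorem svd (R : realType) (n : nat) (B : 'M[R]_n) :
  exists (P Q : 'M[R]_n) (l : 'rV[R]_n),
    [/\ P *m P^T = 1%:M, Q *m Q^T = 1%:M, forall i, 0 <= l 0 i
      & B = P *m diag_mx l *m Q].
Proof.
elim: n B => [|n ih] B.
  by exists 1%:M, 1%:M, 0; split; do ?[by case|by apply/matrixP => -[]].
have [v v1 vB] := max_gain B.
have [u u1 [s s0 vBu]] : exists2 u : 'rV[R]_n.+1, dotv u u = 1 &
    exists2 s, 0 <= s & v *m B = s *: u.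
  have [vB0|vB0] := eqVneq (v *m B) 0.
    by exists v => //; exists 0; rewrite ?scale0r.
  have e0 : enorm (v *m B) != 0 by rewrite enorm_eq0.
  exists ((enorm (v *m B))^-1 *: (v *m B)).
    by rewrite dotvZl dotvZr -enorm_sqr; field.
  by exists (enorm (v *m B)); rewrite ?enorm_ge0// scalerA divff// scale1r.
have [H1 H1o H1v] := householder v1.
have [H2 H2o H2u] := householder u1.
have H1o' : H1^T *m H1 = 1%:M by apply: mulmx1C.
have H2o' : H2^T *m H2 = 1%:M by apply: mulmx1C.
pose C : 'M[R]_(1 + n) := H1 *m B *m H2^T.
have CE i j : C i j = dotv (delta_mx 0 i *m H1 *m B) (delta_mx 0 j *m H2).
  rewrite -[H2 in RHS]trmxK -dotv_mulmx dotv_delta -!mulmxA (mulmxA H1) -rowE.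
  by rewrite [RHS]mxE.
have BC : B = H1^T *m C *m H2.
  by rewrite /C !mulmxA H1o' mul1mx -mulmxA H2o' mulmx1.
move: C CE BC => C CE BC.
have C00 j : C 0 j = s * (j == 0)%:R.
  rewrite CE H1v vBu dotvZl -H2u dotv_mulmx -mulmxA H2o mulmx1 dotvC dotv_delta.
  by rewrite mxE eqxx /= eq_sym.
have Ci0 i : i != 0 -> C i 0 = 0.
  move=> i0; rewrite CE H2u.
  have wv : dotv (delta_mx 0 i *m H1) v = 0.
    rewrite -H1v dotv_mulmx -mulmxA H1o mulmx1 dotv_delta mxE eqxx/=.
    by rewrite eq_sym (negbTE i0).
  have := max_gain_orthogonal v1 vB wv; rewrite vBu dotvZr.
  (* For [s = 0] orthogonality to [s *: u] carries no information, but then the maximal gain is zero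
     and every image under [B] vanishes. *)
  have [s00|sn0] := eqVneq s 0; last by move/eqP;
    rewrite mulf_eq0 (negbTE sn0) => /eqP.
  move=> _; suff -> : delta_mx 0 i *m H1 *m B =
    0 :> 'rV[R]_n.+1 by rewrite dot0v.
  apply/eqP; rewrite -dotvv_eq0 eq_le dotvv_ge0 andbT.
  by rewrite (le_trans (vB _))// vBu s00 scale0r dot0v mul0r.
have [P [Q [l [Po Qo l0 CE']]]] := ih (drsubmx C).
have CB : C = block_mx s%:M 0 0 (drsubmx C).
  rewrite -[LHS]submxK; congr block_mx; apply/matrixP => i j.
  - by rewrite !ord1 !mxE lshift0 C00 eqxx mulr1.
  - rewrite !ord1 !mxE [lshift _ _]lshift0 C00.
    by rewrite -(inj_eq val_inj) /= mulr0.
  - by rewrite !ord1 !mxE [lshift _ _]lshift0 Ci0// -(inj_eq val_inj).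
pose l' : 'rV[R]_(1 + n) := row_mx s%:M l.
pose b1 (A : 'M[R]_n) : 'M[R]_(1 + n) := block_mx (1%:M : 'M[R]_1) 0 0 A.
exists (H1^T *m (b1 P : 'M[R]_n.+1)), ((b1 Q : 'M[R]_n.+1) *m H2), l'.
have bo (A : 'M[R]_n) : A *m A^T = 1%:M ->
    b1 A *m (b1 A)^T = 1%:M.
  move=> AA; rewrite /b1 tr_block_mx trmx1 !trmx0 mulmx_block.
  by rewrite !mulmx0 !mul0mx !mulmx1 !addr0 AA add0r -scalar_mx_block.
split.
- by rewrite trmx_mul trmxK mulmxA -(mulmxA H1^T) bo// mulmx1.
- by rewrite trmx_mul mulmxA -(mulmxA _ H2) H2o mulmx1 bo.
- move=> i; rewrite mxE; case: splitP => k _ //.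
  by rewrite ord1 mxE eqxx mulr1n.
- have key : block_mx s%:M 0 0 (P *m diag_mx l *m Q) =
  b1 P *m diag_mx l' *m b1 Q.
    rewrite /b1 /l' diag_mx_row !mulmx_block !mulmx0 !mul0mx !mulmx1 !mul1mx.
    rewrite !addr0 ?add0r ?mul0mx ?mulmx0 ?addr0; congr block_mx.
    by apply/matrixP => i j; rewrite !ord1 !mxE.
  by rewrite [LHS]BC CB CE' key !mulmxA.
Qed.

(** * Maximal inscribed ellipsoids *)

Definition convexv (R : realType) (d : nat) (K : set 'rV[R]_d) : Prop :=
  forall x y t, K x -> K y -> 0 <= t <= 1 -> K ((1 - t) *: x + t *: y).

(** Matrix determinant lemma: both sides are the determinant of one bordered matrix, factored into
    triangular blocks in two ways. *)
Lemma det_rank1 (R : comNzRingType) (n : nat) (e w : 'rV[R]_n) :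
  \det (1%:M + e^T *m w) = 1 + (w *m e^T) 0 0.
Proof.
have XL : block_mx 1%:M (- w) e^T 1%:M =
    block_mx (1%:M : 'M[R]_1) 0 e^T 1%:M *m
    block_mx 1%:M (- w) 0 (1%:M + e^T *m w).
  rewrite mulmx_block !mulmx0 !mul0mx !mul1mx !mulmx1 !addr0 mulmxN.
  by rewrite addrCA addNr addr0.
have XR : block_mx 1%:M (- w) e^T 1%:M =
    block_mx (1%:M + w *m e^T) (- w) 0 1%:M *m
    block_mx (1%:M : 'M[R]_1) 0 e^T 1%:M.
  rewrite mulmx_block ?mulmx0 ?mul0mx !mul1mx !mulmx1 ?addr0 ?add0r mulNmx.
  by rewrite addrK.
have := congr1 determinant XL; rewrite XR !det_mulmx !det_lblock !det_ublock.
by rewrite !det1 !mul1r !mulr1 => <-; rewrite det_mx11 mxE mxE eqxx.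
Qed.

Lemma prod_1D_ge (R : realDomainType) (I : Type) (r : seq I) (x : I -> R) :
  (forall i, 0 <= x i) -> 1 + \sum_(i <- r) x i <= \prod_(i <- r) (1 + x i).
Proof.
move=> x0; elim: r => [|i r ih]; first by rewrite !big_nil addr0.
rewrite !big_cons (le_trans _ (ler_wpM2l _ ih)) ?addr_ge0//.
have S0 : 0 <= \sum_(j <- r) x j by exact: sumr_ge0.
have := mulr_ge0 (x0 i) S0; nra.
Qed.

(** Weierstrass product inequality, multiplied out so that the sign of [1 - \sum x] does not
    matter. *)
Lemma prod_1D_le (R : realDomainType) (I : Type) (r : seq I) (x : I -> R) :
  (forall i, 0 <= x i) ->
  \prod_(i <- r) (1 + x i) * (1 - \sum_(i <- r) x i) <= 1.
Proof.
move=> x0; elim: r => [|i r ih]; first by rewrite !big_nil subr0 mulr1.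
rewrite !big_cons; have S0 : 0 <= \sum_(j <- r) x j by exact: sumr_ge0.
have P0 : 0 <= \prod_(j <- r) (1 + x j).
  by apply: prodr_ge0 => j _; rewrite addr_ge0.
apply: le_trans ih; rewrite -mulrA mulrCA ler_wpM2l//.
have := mulr_ge0 (x0 i) S0; have := sqr_ge0 (x i); nra.
Qed.

(** AM-GM for the semi-axes [1] and [l] with its exact excess: the squared mean exceeds the product
    [l] by the relative amount [(l - 1) ^+ 2 / (4 * l)]. *)
Lemma mean_sqr_gain (R : realFieldType) (l : R) : 0 < l ->
  ((1 + l) / 2) ^+ 2 = l * (1 + (l - 1) ^+ 2 / (4 * l)).
Proof. by move=> l0; field; rewrite gt_eqF. Qed.

(** A single axis far from [1] already reaches the threshold that [improve_mean] asks of the whole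
    product. *)
Lemma far_gain (R : realFieldType) (l : R) : 0 < l -> 1 / 2 < `|l - 1| ->
  1 / 600 <= (l - 1) ^+ 2 / (4 * l).
Proof.
move=> l0 h; rewrite ler_pdivlMr ?mulr_gt0//.
by move: h; case: (ler0P (l - 1)) => _ h; nra.
Qed.

Lemma near_gain (R : realFieldType) (l : R) : 0 < l -> `|l - 1| <= 1 / 2 ->
  (l - 1) ^+ 2 / 6 <= (l - 1) ^+ 2 / (4 * l).
Proof.
move=> l0; rewrite ler_norml => /andP[_ h].
rewrite ler_wpM2l ?sqr_ge0// lef_pV2 ?posrE ?mulr_gt0//; lra.
Qed.

Lemma ler_norm_sqr (R : realDomainType) (x y : R) :
  0 <= y -> y ^+ 2 <= x ^+ 2 -> y <= `|x|.
Proof.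
by move=> y0; rewrite -(real_normK (num_real x)) ler_pXn2r// nnegrE.
Qed.

Lemma mx_diagE (R : comNzRingType) (n : nat) (u l : 'rV[R]_n) i :
  (u *m diag_mx l) 0 i = u 0 i * l 0 i.
Proof. by rewrite mul_mx_diag mxE. Qed.

(** The case of two different shapes. Midpoints of points with the same parameter [u] form an
    ellipsoid with semi-axes [(1 + l_i) / 2]; the AM-GM excess [1 / 600] outweighs both the loss
    [1 / 2000] and the squared gain [(1 + 1 / 2000) ^+ 2] to be reached. *)
Lemma improve_mean (R : realType) (d : nat) (K : set 'rV[R]_d)
    (a l : 'rV[R]_d) :
  convexv K ->
  (forall u, enorm u <= 1 -> K u) ->
  (forall u, enorm u <= 1 -> K (a + u *m diag_mx l)) ->
  (forall i, 0 < l 0 i) ->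
  1 - 1 / 2000 <= \prod_(i < d) l 0 i ->
  1 + 1 / 600 <= \prod_(i < d) (1 + (l 0 i - 1) ^+ 2 / (4 * l 0 i)) ->
  exists c M, (forall u, enorm u <= 1 -> K (c + u *m M)) /\
    1 + 1 / 2000 <= `|\det M|.
Proof.
move=> cK K1 Ka l0 pl pg.
pose m : 'rV[R]_d := \row_i ((1 + l 0 i) / 2).
exists ((1 / 2) *: a), (diag_mx m); split.
  move=> u u1; have := cK _ _ (1 / 2) (K1 u u1) (Ka u u1).
  have -> : (1 - 1 / 2) *: u + (1 / 2) *: (a + u *m diag_mx l) =
      (1 / 2) *: a + u *m diag_mx m.
    by rewrite !mul_mx_diag; apply/rowP => i; rewrite !mxE; field.
  by apply; lra.
apply: ler_norm_sqr; first by lra.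
rewrite det_diag -prodrXl.
under eq_bigr => i _ do rewrite mxE mean_sqr_gain//.
rewrite big_split /=.
apply: le_trans (_ : (1 - 1 / 2000) * (1 + 1 / 600) <= _); first by lra.
by apply: ler_pM; [lra|lra|exact: pl|exact: pg].
Qed.

(** Balance of [improve_near]: [A] is the squared product of the axes [gm], [B] and [S] are the
    product and sum controlling the shrinkage [y], and [1 + v] is the rank-one determinant. In
    essence, [(104 / 100) ^+ 2 * (96 / 100)] exceeds [1]. *)
Lemma near_gain_arith (R : realFieldType) (A B S v : R) :
  0 <= A -> B * (1 - S) <= 1 -> 1 - 1 / 2000 <= A * B -> S <= 4 / 100 ->
  4 / 100 <= v -> (1 + 1 / 2000) ^+ 2 <= (1 + v) ^+ 2 * A.
Proof.
move=> A0 BS AB S4 v4.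
have A1 : (1 - 1 / 2000) * (96 / 100) <= A.
  apply: (@le_trans _ _ (A * (B * (1 - S)))); last by rewrite ler_piMr.
  rewrite [leRHS]mulrA; apply: ler_pM; [lra|lra|exact: AB|lra].
apply: (@le_trans _ _ ((104 / 100) ^+ 2 * ((1 - 1 / 2000) * (96 / 100)))).
  by lra.
apply: ler_pM; [lra|lra| |exact: A1].
by apply: lerXn2r; [rewrite nnegrE; lra|rewrite nnegrE; lra|lra].
Qed.

(* The hull of the unit ball and of the translate [a + diag l] of an almost
   equal ellipsoid contains an ellipsoid elongated along [a]: a point [u] is
   sent to the combination of [u'] and [a + u' diag l] with the weight
   [t = 1/2 + <u, e>/5], [e = a/|a|], so that the term [t a] stretches the
   direction [a].  The factors [y i] and the rank-one term [- e/25] in [w]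
     shrink
   [u'] just enough to keep it in the ball; they cost less than is gained. *)
Lemma improve_near (R : realType) (d : nat) (K : set 'rV[R]_d)
    (a l : 'rV[R]_d) :
  convexv K ->
  (forall u, enorm u <= 1 -> K u) ->
  (forall u, enorm u <= 1 -> K (a + u *m diag_mx l)) ->
  (forall i, `|l 0 i - 1| <= 1 / 2) ->
  \sum_(i < d) (l 0 i - 1) ^+ 2 <= 1 / 100 ->
  1 / 2 <= enorm a ->
  1 - 1 / 2000 <= \prod_(i < d) l 0 i ->
  exists c M, (forall u, enorm u <= 1 -> K (c + u *m M)) /\
    1 + 1 / 2000 <= `|\det M|.
Proof.
move=> cK K1 Ka ln ls a2 pl.
pose dl i := l 0 i - 1.
have dln i : - (1 / 2) <= dl i <= 1 / 2 by rewrite -ler_norml ln.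
have a0 : 0 < enorm a by lra.
pose e := (enorm a)^-1 *: a.
have ee : dotv e e = 1.
  by rewrite dotvZl dotvZr -enorm_sqr; field; rewrite gt_eqF.
have ae i : a 0 i = enorm a * e 0 i by rewrite mxE mulrA divff ?gt_eqF// mul1r.
move: e ee ae => e ee ae.
pose y i := (Num.sqrt (1 + 4 * dl i ^+ 2))^-1.
have S0 i : 0 < 1 + 4 * dl i ^+ 2 by have := sqr_ge0 (dl i); lra.
have y0 i : 0 < y i by rewrite invr_gt0 sqrtr_gt0.
have y2 i : y i ^+ 2 = (1 + 4 * dl i ^+ 2)^-1.
  by rewrite exprVn sqr_sqrtr// ltW.
have y1 i : y i <= 1.
  rewrite -(@ler_pXn2r _ 2)// ?nnegrE ?(ltW (y0 _))// expr1n y2 invf_le1//.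
  by have := sqr_ge0 (dl i); lra.
pose gm i := y i * (1 + dl i / 2).
have gm0 i : 0 < gm i by apply: mulr_gt0 => //; have := dln i; lra.
have gm1 i : gm i <= 5 / 4.
  have := dln i => dlni; apply: (@le_trans _ _ (1 * (1 + dl i / 2))); last lra.
  by apply: ler_wpM2r => //; lra.
(* Dividing by [gm i] undoes the later factor [diag_mx G], so that the first term of [w] contributes
   exactly [(dotv u e / 5) *: a]. *)
pose w : 'rV[R]_d := \row_i (a 0 i / (5 * gm i) - e 0 i / 25).
pose G : 'rV[R]_d := \row_i gm i.
pose M := (1%:M + e^T *m w) *m diag_mx G.
have uM (u : 'rV[R]_d) i : (u *m M) 0 i =
    (u 0 i - dotv u e / 25 * e 0 i) * gm i + dotv u e / 5 * a 0 i.
  rewrite /M mulmxA mx_diagE mulmxDr mulmx1 mulmxA mxE.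
  have -> : u *m e^T = (dotv u e)%:M.
    by rewrite dotvE; apply/matrixP => r c; rewrite !ord1 [RHS]mxE eqxx.
  rewrite mul_scalar_mx [X in _ + X]mxE [w 0 i]mxE [G 0 i]mxE.
  by field; rewrite gt_eqF.
exists ((1 / 2) *: a), M; split.
  move=> u u1; pose p := dotv u e.
  have enorm_e : enorm e = 1.
    by apply/eqP; rewrite -(@eqrXn2 _ 2)// ?enorm_ge0// enorm_sqr ee expr1n.
  have p1 : -1 <= p <= 1.
    rewrite -ler_norml (le_trans (cauchy_schwarz_abs _ _))//.
    by rewrite enorm_e mulr1.
  pose t := 1 / 2 + p / 5.
  pose w' i := u 0 i - p / 25 * e 0 i.
  have td i : 1 / 2 <= 1 + t * dl i.
    by rewrite /t; move: (dln i) p1; clear; nra.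
  have td0 i : 1 + t * dl i != 0 by rewrite gt_eqF//; have := td i; lra.
  (* The combination has coordinates [(1 + t * dl i) * u'_i + t * a_i], and the part without [a]
     must equal [gm i * w' i]. Since [t - 1 / 2 = p / 5], the quotient
     [(1 + dl i / 2) / (1 + t * dl i)] is the first factor here. *)
  pose u' : 'rV[R]_d := \row_i ((1 - p / 5 * (dl i / (1 +
    t * dl i))) * y i * w' i).
  have u'1 : enorm u' <= 1.
    rewrite ler_enorm// expr1n.
    apply: (@le_trans _ _ (\sum_(i < d) (1 + p ^+ 2 / 25) * w' i ^+ 2)).
      apply: ler_sum => i _; rewrite mxE -expr2 exprMn ler_wpM2r ?sqr_ge0//.
      rewrite exprMn y2 ler_pdivrMr//; set r := dl i / _.
      have r2 : r ^+ 2 <= 4 * dl i ^+ 2.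
        rewrite expr_div_n ler_pdivrMr ?exprn_even_gt0 ?td0//.
        rewrite mulrAC ler_peMl ?sqr_ge0//.
        by have := td i; nra.
      (* Lagrange's identity in the plane. The factor [1 + r ^+ 2] is absorbed by [y i ^+ 2], which
         leaves [1 + p ^+ 2 / 25]. *)
      have : (1 - p / 5 * r) ^+ 2 + (p / 5 + r) ^+ 2 =
        (1 + p ^+ 2 / 25) * (1 + r ^+ 2) by field.
      have := sqr_ge0 (p / 5 + r).
      have : (1 + p ^+ 2 / 25) * (1 + r ^+ 2) <= (1 + p ^+ 2 / 25) * (1 +
        4 * dl i ^+ 2).
        by apply: ler_wpM2l; [have := sqr_ge0 p; lra|rewrite lerD2l].
      lra.
    rewrite -mulr_sumr.
    (* The shrinkage along [e] makes this at most [1 - p ^+ 2 / 25], which compensates the remaining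
       factor [1 + p ^+ 2 / 25]. *)
    have -> : \sum_(i < d) w' i ^+ 2 =
      dotv u u - 2 * (p / 25) * p + (p / 25) ^+ 2.
      transitivity (dotv (u - (p / 25) *: e) (u - (p / 25) *: e)).
        by apply: eq_bigr => i _; rewrite !mxE -expr2.
      by rewrite !(dotvBl, dotvBr, dotvZl, dotvZr) ee (dotvC e u) -/p; ring.
    have uu : dotv u u <= 1 by rewrite -enorm_sqr expr_le1// enorm_ge0.
    have p2 := sqr_ge0 p.
    apply: (@le_trans _ _ ((1 + p ^+ 2 / 25) * (1 - p ^+ 2 / 25))).
      by rewrite ler_wpM2l//; [lra|nra].
    by nra.
  have := cK _ _ t (K1 _ u'1) (Ka _ u'1).
  have -> : (1 - t) *: u' + t *: (a + u' *m diag_mx l) = (1 / 2) *: a + u *m M.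
    apply/rowP => i; rewrite [RHS]mxE uM -/p mul_mx_diag !mxE.
    have -> : l 0 i = 1 + dl i by rewrite /dl; lra.
    rewrite /gm -/(w' i).
    have tdi := td i; rewrite /t in tdi *; field.
    by apply: lt0r_neq0; lra.
  by apply; rewrite /t; lra.
apply: ler_norm_sqr; first by lra.
rewrite det_mulmx det_rank1 det_diag -dotvE.
have -> : \prod_(i < d) G 0 i = \prod_(i < d) gm i.
  by apply: eq_bigr => i _; rewrite mxE.
(* From [enorm a >= 1 / 2] and [gm i <= 5 / 4] the stretching contributes at least [2 / 25], and the
   shrinkage along [e] costs [1 / 25]. *)
have we : 4 / 100 <= dotv w e.
  have -> : dotv w e = \sum_(i < d) enorm a * e 0 i ^+ 2 / (5 * gm i) - 1 / 25.
    have -> : 1 / 25 = dotv e e / 25 by rewrite ee.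
    rewrite /dotv mulr_suml -sumrB.
    by apply: eq_bigr => i _; rewrite mxE ae; field; rewrite gt_eqF.
  have : \sum_(i < d) (1 / 2) * e 0 i ^+ 2 * (4 / 25) <=
      \sum_(i < d) enorm a * e 0 i ^+ 2 / (5 * gm i).
    apply: ler_sum => i _; apply: ler_pM.
    - by rewrite mulr_ge0 ?sqr_ge0//; lra.
    - by lra.
    - by rewrite ler_wpM2r ?sqr_ge0//; lra.
    - have := gm1 i; have := gm0 i; move: (gm i) => x x0 x1.
      rewrite -[X in _ <= X]mul1r ler_pdivlMr; lra.
  rewrite -mulr_suml -mulr_sumr.
  have -> : \sum_(i < d) e 0 i ^+ 2 = 1.
    by rewrite -ee; apply: eq_bigr => i _; rewrite expr2.
  lra.
have P1 : \prod_(i < d) (1 +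
  4 * dl i ^+ 2) * (1 - \sum_(i < d) 4 * dl i ^+ 2) <= 1.
  by apply: prod_1D_le => i; rewrite mulr_ge0 ?sqr_ge0.
(* Axis by axis, [gm i ^+ 2 * (1 + 4 * dl i ^+ 2) = (1 + dl i / 2) ^+ 2], which is at least
   [1 + dl i = l 0 i]. *)
have gP : (\prod_(i < d) gm i) ^+ 2 * \prod_(i < d) (1 +
  4 * dl i ^+ 2) >= 1 - 1 / 2000.
  rewrite -prodrXl -big_split /= (le_trans pl)//; apply: ler_prod => i _.
  have -> : gm i ^+ 2 * (1 + 4 * dl i ^+ 2) = (1 + dl i / 2) ^+ 2.
    by rewrite exprMn y2 mulrAC mulVf ?gt_eqF// mul1r.
  have := sqr_ge0 (dl i); have := dln i.
  have -> : l 0 i = 1 + dl i by rewrite /dl; lra.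
  by clear; nra.
have S100 : \sum_(i < d) 4 * dl i ^+ 2 <= 4 / 100.
  by rewrite -mulr_sumr; rewrite /dl; lra.
have g2 := sqr_ge0 (\prod_(i < d) gm i).
move: P1 gP S100 g2.
set A := (\prod_(i < d) gm i) ^+ 2.
set B := \prod_(i < d) (1 + _); set S := \sum_(i < d) _ => P1 gP S100 g2.
by rewrite exprMn -/A; exact: near_gain_arith gP S100 we.
Qed.

(** Either averaging the axes gains enough, or the total excess is below [1 / 600]. In the latter
    case no axis is far from [1], the squared deviations sum to at most [6 / 600], and the cut
    forces the centers apart: an almost round ellipsoid on one side of a hyperplane through [0] has
    its center at distance at least [1 / 2]. *)
Lemma improve_diag (R : realType) (d : nat) (K : set 'rV[R]_d)
    (a l g : 'rV[R]_d) :
  convexv K ->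
  (forall u, enorm u <= 1 -> K u) ->
  (forall u, enorm u <= 1 -> K (a + u *m diag_mx l)) ->
  (forall u, enorm u <= 1 -> dotv g (a + u *m diag_mx l) <= 0) ->
  g != 0 ->
  (forall i, 0 < l 0 i) ->
  1 - 1 / 2000 <= \prod_(i < d) l 0 i ->
  exists c M, (forall u, enorm u <= 1 -> K (c + u *m M)) /\
    1 + 1 / 2000 <= `|\det M|.
Proof.
move=> cK K1 Ka cut g0 l0 pl.
have [pg|] := leP (1 + 1 / 600)
  (\prod_(i < d) (1 + (l 0 i - 1) ^+ 2 / (4 * l 0 i))).
  exact: (improve_mean cK K1 Ka l0 pl pg).
pose x i := (l 0 i - 1) ^+ 2 / (4 * l 0 i).
have x0 i : 0 <= x i by rewrite divr_ge0 ?sqr_ge0// mulr_ge0// ltW.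
move=> /(le_lt_trans (prod_1D_ge (index_enum 'I_d) x0)); rewrite ltrD2l => S.
have ln i : `|l 0 i - 1| <= 1 / 2.
  rewrite leNgt; apply/negP => /(far_gain (l0 i)).
  apply/negP; rewrite -ltNge; apply: le_lt_trans S.
  rewrite (bigD1 i)//= lerDl; exact: sumr_ge0.
apply: (improve_near cK K1 Ka ln _ _ pl).
  have : \sum_(i < d) (l 0 i - 1) ^+ 2 / 6 <= \sum_(i < d) x i.
    by apply: ler_sum => i _; apply: near_gain.
  rewrite -mulr_suml; lra.
pose h := g *m diag_mx l.
have hi i : h 0 i = g 0 i * l 0 i by rewrite /h mx_diagE.
have gh : enorm g / 2 <= enorm h.
  rewrite -[enorm g / 2]ger0_norm ?divr_ge0 ?enorm_ge0// -(ger0_norm (enorm_ge0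
    h)).
  rewrite -ler_sqr// !(ger0_norm) ?divr_ge0 ?enorm_ge0// expr_div_n !enorm_sqr.
  rewrite /dotv mulr_suml; apply: ler_sum => i _; rewrite hi.
  have := ln i; rewrite ler_norml => /andP[ln1 _].
  have l2 : 1 / 4 <= l 0 i ^+ 2 by move: ln1; move: (l 0 i) => z hz; nra.
  have := sqr_ge0 (g 0 i); move: l2; move: (l 0 i) (g 0 i) => y z hy hz; nra.
have g1 : 0 < enorm g by rewrite enorm_gt0.
have h0 : 0 < enorm h by lra.
(* This unit vector maximizes the linear form [g] over the second ellipsoid; the maximum is
   [dotv g a + enorm h]. *)
have := cut ((enorm h)^-1 *: h).
rewrite enormZ ger0_norm ?invr_ge0 ?enorm_ge0// mulVf ?gt_eqF// => /(_ (lexx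
  _)).
rewrite dotvDr -scalemxAl dotvZr dotvC.
have -> : dotv g (h *m diag_mx l) = enorm h ^+ 2.
  by rewrite enorm_sqr {2}/h dotvC dotv_mulmx tr_diag_mx dotvC dotv_mulmx
    tr_diag_mx dotvC.
rewrite expr2 mulKf ?gt_eqF// dotvC => H.
have := cauchy_schwarz (- g) a; rewrite dotvNl enormN => H'.
have : enorm g * (1 / 2) <= enorm g * enorm a by lra.
by rewrite ler_pM2l.
Qed.

Lemma det_orthogonal (R : realType) (n : nat) (Q : 'M[R]_n) :
  Q *m Q^T = 1%:M -> `|\det Q| = 1.
Proof.
move=> /(congr1 determinant); rewrite det_mulmx det_tr det1 -expr2 => q1.
apply/eqP; rewrite -(@eqrXn2 _ 2)//.
by rewrite real_normK ?num_real// q1 expr1n.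
Qed.

(** Reduction to [improve_diag] by the affine map [v |-> c0 + v *m B] with [B = Q *m B0]. It sends
    the unit ball to the first ellipsoid, and the decomposition of [B1 *m invmx B0] makes the second
    one diagonal; the orthogonal factors only reparametrize the balls. The cut normal becomes
    [g *m B^T]. *)
Lemma improve_ellipsoid (R : realType) (d : nat) (K : set 'rV[R]_d)
    (c0 c1 g : 'rV[R]_d) (B0 B1 : 'M[R]_d) :
  convexv K ->
  (forall u, enorm u <= 1 -> K (c0 + u *m B0)) ->
  (forall u, enorm u <= 1 -> K (c1 + u *m B1)) ->
  (forall u, enorm u <= 1 -> dotv g (c1 + u *m B1 - c0) <= 0) ->
  g != 0 -> \det B0 != 0 ->
  (1 - 1 / 2000) * `|\det B0| <= `|\det B1| ->
  exists c M, (forall u, enorm u <= 1 -> K (c + u *m M)) /\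
    (1 + 1 / 2000) * `|\det B0| <= `|\det M|.
Proof.
move=> cK K0 K1 cut g0 B00 B01.
have B0u : B0 \in unitmx by rewrite unitmxE unitfE.
have [P [Q [l [Po Qo l0 BE]]]] := svd (B1 *m invmx B0).
have Po' : P^T *m P = 1%:M by apply: mulmx1C.
have Qu : Q \in unitmx by case: (mulmx1_unit Qo).
pose B := Q *m B0.
have Bu : B \in unitmx by rewrite unitmx_mul Qu.
have detB : `|\det B| =
  `|\det B0| by rewrite det_mulmx normrM (det_orthogonal Qo) mul1r.
pose a := (c1 - c0) *m invmx B.
pose K' := [set v | K (c0 + v *m B)].
have B1E : P^T *m B1 = diag_mx l *m B.
  by rewrite /B mulmxA -[B1](mulmxKV B0u) BE !mulmxA Po' mul1mx.
have FE u : c0 + (a + u *m diag_mx l) *m B = c1 + (u *m P^T) *m B1.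
  rewrite mulmxDl mulmxKV// -(mulmxA u P^T) B1E -mulmxA addrA.
  by rewrite addrCA subrr addr0.
have uP u : enorm (u *m P^T) = enorm u by rewrite enorm_orthogonal// trmxK.
have dl : `|\det (B1 *m invmx B0)| = \prod_(i < d) l 0 i.
  rewrite BE !det_mulmx !normrM (det_orthogonal Po) (det_orthogonal Qo) mulr1
    mul1r det_diag.
  by rewrite ger0_norm// prodr_ge0.
have pl : 1 - 1 / 2000 <= \prod_(i < d) l 0 i.
  rewrite -dl det_mulmx det_inv normrM normfV ler_pdivlMr//.
  by rewrite normr_gt0.
have [|||||||c [M [cM detM]]] := @improve_diag _ _ K' a l (g *m B^T).
- move=> x y t Kx Ky t01; rewrite /K' /=.
  have -> : c0 + ((1 - t) *: x + t *: y) *m B =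
      (1 - t) *: (c0 + x *m B) + t *: (c0 + y *m B).
    rewrite mulmxDl -!scalemxAl !scalerDr addrACA -scalerDl subrK scale1r//.
  exact: cK.
- by move=> u u1; rewrite /K'/= /B mulmxA; apply: K0; rewrite enorm_orthogonal.
- by move=> u u1; rewrite /K'/= FE; apply: K1; rewrite uP.
- move=> u u1; rewrite -[B^T]trmxK trmxK -{1}[B]trmxK trmxK.
  rewrite dotvC -dotv_mulmx dotvC.
  have -> : (a + u *m diag_mx l) *m B = c1 + u *m P^T *m B1 - c0.
    by rewrite -FE addrAC subrr add0r.
  by apply: cut; rewrite uP.
- apply/eqP => /(congr1 (fun v => v *m invmx B^T)).
  rewrite mulmxK ?unitmx_tr// mul0mx; exact/eqP.
- move=> i; rewrite lt_def l0 andbT; apply: contraTneq pl => li.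
  by rewrite (bigD1 i)//= li mul0r; lra.
- by exact: pl.
exists (c0 + c *m B), (M *m B); split.
  move=> u u1; rewrite -addrA mulmxA -mulmxDl; exact: cM.
by rewrite det_mulmx normrM detB ler_wpM2r.
Qed.

(* Made opaque because conversion on the unary numeral 2000 blows up. *)
Lemma gain_exists (R : realType) : {dl : R | 0 < dl < 1 &
  forall (d : nat) (K : set 'rV[R]_d) (c0 c1 g : 'rV[R]_d) (B0 B1 : 'M[R]_d),
  convexv K ->
  (forall u, enorm u <= 1 -> K (c0 + u *m B0)) ->
  (forall u, enorm u <= 1 -> K (c1 + u *m B1)) ->
  (forall u, enorm u <= 1 -> dotv g (c1 + u *m B1 - c0) <= 0) ->
  g != 0 -> \det B0 != 0 ->
  (1 - dl) * `|\det B0| <= `|\det B1| ->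
  exists c M, (forall u, enorm u <= 1 -> K (c + u *m M)) /\
    (1 + dl) * `|\det B0| <= `|\det M|}.
Proof. by exists (1 / 2000); [lra|exact: improve_ellipsoid]. Qed.

Definition gain (R : realType) : R := s2val (gain_exists R).

Lemma gain_gt0 (R : realType) : 0 < gain R.
Proof. by case/andP: (s2valP (gain_exists R)). Qed.

Lemma gain_lt1 (R : realType) : gain R < 1.
Proof. by case/andP: (s2valP (gain_exists R)). Qed.

(** * The cutting-plane method *)

Definition ellipsoid_in (R : realType) (d : nat) (K : set 'rV[R]_d)
    (c : 'rV[R]_d) (B : 'M[R]_d) : Prop :=
  forall u, enorm u <= 1 -> K (c + u *m B).

(** Opposite ends of a principal axis are at distance [2 * l 0 i] and both lie in the ball, so each
    singular value is at most [rho]. *)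
Lemma ellipsoid_in_ball_det (R : realType) (d : nat) (rho : R)
    (c : 'rV[R]_d) (B : 'M[R]_d) :
  ellipsoid_in [set x | enorm x <= rho] c B -> `|\det B| <= rho ^+ d.
Proof.
move=> cB; have [P [Q [l [Po Qo l0 BE]]]] := svd B.
have Po' : P^T *m P = 1%:M by apply: mulmx1C.
rewrite BE !det_mulmx !normrM (det_orthogonal Po) (det_orthogonal Qo).
rewrite mulr1 mul1r det_diag ger0_norm ?prodr_ge0//.
apply: (@le_trans _ _ (\prod_(i < d) rho)); last first.
  by rewrite prodr_const card_ord.
apply: ler_prod => i _; rewrite l0 /=.
pose u : 'rV[R]_d := delta_mx 0 i *m P^T.
have u1 : enorm u = 1.
  rewrite enorm_orthogonal ?trmxK//; apply/eqP.
  by rewrite -(@eqrXn2 _ 2)// ?enorm_ge0// enorm_sqr dotv_delta mxE !eqxx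
    expr1n.
have uB : enorm (u *m B) = l 0 i.
  have -> : u *m B = (l 0 i *: delta_mx 0 i) *m Q.
    rewrite /u BE !mulmxA -(mulmxA _ P^T) Po' mulmx1; congr (_ *m _).
    apply/rowP => j; rewrite mul_mx_diag !mxE mulrC.
    by have [->|] := eqVneq j i; rewrite ?mulr0// andbF.
  rewrite enorm_orthogonal// enormZ ger0_norm//.
  have -> : enorm (delta_mx 0 i : 'rV[R]_d) = 1; last by rewrite mulr1.
  apply/eqP.
  by rewrite -(@eqrXn2 _ 2)// ?enorm_ge0// enorm_sqr dotv_delta mxE !eqxx
    expr1n.
have /= h1 := cB u; have /= h2 := cB (- u).
rewrite u1 in h1; rewrite enormN u1 in h2.
have := ler_enormB (c + u *m B) (c + - u *m B).
have -> : c + u *m B - (c + - u *m B) = 2 *: (u *m B).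
  by rewrite mulNmx opprD opprK addrACA subrr add0r -mulr2n scaler_nat.
rewrite enormZ uB ger0_norm//.
by have := h1 (lexx _); have := h2 (lexx _); lra.
Qed.

(** The determinants are bounded by [rho ^+ d]; an ellipsoid above [sup S / (1 + gain R)] serves, so
    attainment of the supremum never has to be proved. *)
Lemma near_max_ellipsoid (R : realType) (d : nat) (K : set 'rV[R]_d) (rho : R)
    (c : 'rV[R]_d) (B : 'M[R]_d) :
  K `<=` [set x | enorm x <= rho] -> ellipsoid_in K c B -> \det B != 0 ->
  exists c0 B0, [/\ ellipsoid_in K c0 B0, \det B0 != 0 &
    forall c1 B1, ellipsoid_in K c1 B1 ->
      `|\det B1| < (1 + gain R) * `|\det B0|].
Proof.
move=> Krho cB B0.
pose S := [set v : R | exists c1 B1, ellipsoid_in K c1 B1 /\ v = `|\det B1|].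
have SB : S `|\det B| by exists c, B.
have Su : has_sup S.
  split; first by exists `|\det B|.
  exists (rho ^+ d) => _ [c1 [B1 [cB1 ->]]].
  by apply: (@ellipsoid_in_ball_det _ _ _ c1) => u /cB1 /Krho.
have S0 : 0 < sup S.
  by rewrite (lt_le_trans _ (sup_upper_bound Su SB))// normr_gt0.
have e0 : 0 < sup S - sup S / (1 + gain R).
  have := gain_gt0 R => g0; rewrite subr_gt0 ltr_pdivrMr; nra.
have [_ [c1 [B1 [cB1 ->]]]] := sup_adherent e0 Su.
rewrite opprB addrCA subrr addr0 => h.
exists c1, B1; split => //.
  by rewrite -normr_gt0 (lt_trans _ h)// divr_gt0//; have := gain_gt0 R; lra.
move=> c2 B2 cB2; apply: le_lt_trans (_ : sup S < _).
  by apply: sup_upper_bound => //; exists c2, B2.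
have g1 : 0 < 1 + gain R by have := gain_gt0 R; lra.
by rewrite mulrC -(ltr_pdivrMr _ _ g1).
Qed.

Section CuttingPlane.
Context (R : realType) (d : nat) (rho : R).
Local Notation V := 'rV[R]_d.
Implicit Types (h : seq (V * V)) (gs : seq V).

Definition region h : set V :=
  [set x | enorm x <= rho /\ forall p, p \in h -> dotv p.2 (x - p.1) <= 0].

Definition near_center (K : set V) (c : V) : Prop :=
  exists B, [/\ ellipsoid_in K c B, \det B != 0 &
    forall c1 B1, ellipsoid_in K c1 B1 ->
      `|\det B1| < (1 + gain R) * `|\det B|].

(* [xget] returns its default [0] when the region has empty interior. *)
Definition next_center h : V := xget 0 (near_center (region h)).

(** Each center is a function of the earlier cuts, so the answers alone determine the whole
    history. *)
Definition hist gs : seq (V * V) :=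
  foldl (fun h g => rcons h (next_center h, g)) [::] gs.

Lemma hist_rcons gs g :
  hist (rcons gs g) = rcons (hist gs) (next_center (hist gs), g).
Proof. by rewrite /hist -cats1 foldl_cat. Qed.

Lemma size_hist gs : size (hist gs) = size gs.
Proof.
by elim/last_ind: gs => // gs g ih; rewrite hist_rcons !size_rcons ih.
Qed.

Lemma nth_hist gs k : (k < size gs)%N ->
  nth (0, 0) (hist gs) k = (next_center (hist (take k gs)), nth 0 gs k).
Proof.
elim/last_ind: gs => // gs g ih; rewrite size_rcons ltnS => kn.
rewrite hist_rcons !nth_rcons size_hist -cats1 take_cat.
have [klt|kge|->] := ltngtP k (size gs); first by rewrite ih.
  by move: kn; rewrite leqNgt kge.
by rewrite subnn take0 cats0.
Qed.

Lemma next_center_ball h : 0 <= rho -> enorm (next_center h) <= rho.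
Proof.
move=> rho0; rewrite /next_center; case: xgetP => [c _ [B [cB _ _]]|_].
  by have [|] := cB 0; rewrite ?enorm0// mul0mx addr0.
by rewrite enorm0.
Qed.

Lemma region_convex h : 0 <= rho -> convexv (region h).
Proof.
move=> rho0 x y t [x1 xh] [y1 yh] /andP[t0 t1]; split.
  rewrite (le_trans (ler_enormD _ _))// !enormZ !ger0_norm ?subr_ge0//.
  apply: (@le_trans _ _ ((1 - t) * rho + t * rho)); last by lra.
  by apply: lerD; apply: ler_wpM2l => //; rewrite subr_ge0.
move=> p ph; have := xh p ph; have := yh p ph.
rewrite !(dotvBr, dotvDr, dotvZr); move: t0 t1.
move: (dotv p.2 x) (dotv p.2 y) (dotv p.2 p.1) => A B C t0 t1 h1 h2.
have h3 : 0 <= t * (C - B) by apply: mulr_ge0 => //; lra.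
have h4 : 0 <= (1 - t) * (C - A) by apply: mulr_ge0; lra.
lra.
Qed.

(** If a new ellipsoid kept more than the fraction [1 - gain R] of the center's one, [gain_exists]
    would put into the old region an ellipsoid contradicting the choice of the center. A zero answer
    cuts nothing, whence [0 \notin gs]. *)
Lemma region_det gs c B : 0 <= rho -> 0 \notin gs ->
  ellipsoid_in (region (hist gs)) c B ->
  `|\det B| <= (1 - gain R) ^+ size gs * rho ^+ d.
Proof.
move=> rho0; elim/last_ind: gs c B => [|gs g ih] c B g0 cB.
  rewrite expr0 mul1r; apply: (@ellipsoid_in_ball_det _ _ _ c).
  by move=> u /cB [].
(* A nondegenerate ellipsoid is what guarantees that [next_center] is a true near center and not the
   default [0]. *)
have [B0|B0] := eqVneq (\det B) 0.
  by rewrite B0 normr0 mulr_ge0 ?exprn_ge0// subr_ge0 ltW// gain_lt1.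
move: g0; rewrite mem_rcons in_cons negb_or eq_sym => /andP[g0 gs0].
move: cB; rewrite hist_rcons => cB.
have cB' : ellipsoid_in (region (hist gs)) c B.
  move=> u /cB[u1 uh]; split => // p ph; apply: uh.
  by rewrite mem_rcons in_cons ph orbT.
have : near_center (region (hist gs)) (next_center (hist gs)).
  have Krho : region (hist gs) `<=` [set x | enorm x <= rho] by move=> x [].
  have [c0 [B1 [h1 h2 h3]]] := near_max_ellipsoid Krho cB' B0.
  by apply: (@xgetPex _ 0); exists c0, B1.
move=> [B1 [h1 h2 h3]].
rewrite size_rcons exprS -mulrA.
apply: (@le_trans _ _ ((1 - gain R) * `|\det B1|)); last first.
  by apply: ler_wpM2l; [rewrite subr_ge0 ltW// gain_lt1|exact: ih h1].
rewrite leNgt; apply/negP => /ltW detB.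
have [|c2 [M [/h3 + h4]]] := s2valP' (gain_exists R) _ _ _ c g _ B
  (region_convex rho0) h1 cB' _ g0 h2 detB.
  by move=> u /cB[_ /(_ (next_center (hist gs), g))]; apply;
    rewrite mem_rcons mem_head.
by apply/negP; rewrite -leNgt.
Qed.

(** If [x] were kept by every cut with margin [eta], so would be the ball of radius [r] around it,
    since a cut varies by at most [r * G <= eta] there. That ball is too large for the final
    region. *)
Lemma cutting_plane_cover gs (r eta G : R) (x : V) :
  0 < r -> 0 <= rho -> 0 < eta ->
  (forall g, g \in gs -> enorm g <= G) -> r * G <= eta ->
  (1 - gain R) ^+ size gs * rho ^+ d < r ^+ d ->
  enorm x + r <= rho ->
  exists2 p, p \in hist gs & dotv p.2 (p.1 - x) <= eta.
Proof.
move=> r0 rho0 eta0 gsG rG vol xr; apply: contrapT => H.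
have H' p : p \in hist gs -> eta < dotv p.2 (p.1 - x).
  by move=> ph; rewrite ltNge; apply/negP => ?; apply: H; exists p.
have Hg p : p \in hist gs -> p.2 \in gs.
  move=> /(nthP (0, 0))[k]; rewrite size_hist => kn <-.
  by rewrite nth_hist// mem_nth.
have Hg' g : g \in gs -> exists2 p, p \in hist gs & p.2 = g.
  move=> /(nthP 0)[k kn <-]; exists (nth (0, 0) (hist gs) k).
    by rewrite mem_nth// size_hist.
  by rewrite nth_hist.
(* A zero answer would have margin [0], below [eta]. *)
have g0 : 0 \notin gs.
  apply/negP => /Hg'[p /H' + p0]; rewrite p0 dot0v; lra.
suff /(region_det rho0 g0) : ellipsoid_in (region (hist gs)) x r%:M.
  by rewrite det_scalar (ger0_norm (exprn_ge0 _ (ltW r0))) leNgt vol.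
move=> u u1.
have ur : enorm (r *: u) <= r.
  by rewrite enormZ gtr0_norm// ler_piMr// ltW.
rewrite mul_mx_scalar; split; first by rewrite (le_trans (ler_enormD _ _))//;
  lra.
move=> p ph; have := H' p ph; have := cauchy_schwarz p.2 (r *: u).
have : enorm p.2 * enorm (r *: u) <= G * r.
  by apply: ler_pM; rewrite ?enorm_ge0// gsG// Hg.
rewrite !(dotvBr, dotvDr); lra.
Qed.

End CuttingPlane.

(** * Gradients of convex Lipschitz functions *)

Lemma derive_grad (R : realType) (d : nat) (f : 'rV[R]_d ->
  R) (x v : 'rV[R]_d) :
  differentiable f x -> 'D_v f x = dotv (grad f x) v.
Proof.
move=> df; rewrite deriveE// [in LHS](row_sum_delta v) linear_sum.
by apply: eq_bigr => i _; rewrite linearZ /= mxE deriveE// [RHS]mulrC.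
Qed.

Lemma convex_grad_le (R : realType) (d : nat) (f : 'rV[R]_d -> R)
    (x y : 'rV[R]_d) :
  differentiable f x -> convex_function (E := 'rV[R]_d) setT f ->
  f x + dotv (grad f x) (y - x) <= f y.
Proof.
move=> df cf; rewrite -derive_grad// addrC -lerBrDr leNgt; apply/negP => lt.
have dv : derivable f x (y - x) by exact: diff_derivable.
have [e /= e0 He] := cvgr_gt _ dv _ lt.
pose h := Num.min (e / 2) (1 / 2).
have h0 : 0 < h by rewrite lt_min !divr_gt0.
have h1 : h <= 1 by rewrite ge_min; apply/orP; right; lra.
have he : h < e by rewrite gt_min; apply/orP; left; lra.
have := He h; rewrite /ball /= sub0r normrN gtr0_norm// => /(_ he).
rewrite gt_eqF// => /(_ isT).
apply/negP; rewrite -leNgt /GRing.scale /= -ler_pdivlMl ?invr_gt0// invrK.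
have := cf (Itv01 (ltW h0) h1) y x; rewrite !inE => /(_ I I).
rewrite convRE /conv /=.
have -> : h *: y + (1 - h) *: x = h *: (y - x) + x.
  by rewrite scalerBr scalerBl scale1r addrAC addrA.
rewrite /unstable.onem => cv.
have {}cv : f (h *: (y - x) + x) <= h * f y + (1 - h) * f x by [].
change (f (h *: (y - x) + x) - f x <= h * (f y - f x)).
lra.
Qed.

(** The step from [x] to [x + grad f x] raises [f] by at least [enorm (grad f x) ^+ 2] and by at
    most [L * enorm (grad f x)]. *)
Lemma enorm_grad_le (R : realType) (d : nat) (L : R) (f : 'rV[R]_d -> R)
    (x : 'rV[R]_d) :
  differentiable f x -> convex_function (E := 'rV[R]_d) setT f ->
  (forall x y, `|f x - f y| <= L * enorm (x - y)) -> 0 <= L ->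
  enorm (grad f x) <= L.
Proof.
move=> df cf Lf L0; have [->|g0] := eqVneq (grad f x) 0;
  first by rewrite enorm0.
have := convex_grad_le (x + grad f x) df cf.
have := Lf (x + grad f x) x;
  rewrite addrAC subrr add0r ler_norml => /andP[_ h1 h2].
have : enorm (grad f x) * enorm (grad f x) <= L * enorm (grad f x).
  by rewrite -expr2 enorm_sqr; lra.
by rewrite ler_pM2r// enorm_gt0.
Qed.

(** * Projected online gradient descent *)

Section OnlineGradient.
Context (R : realType) (d : nat).
Local Notation V := 'rV[R]_d.

Lemma ball_projection (Rad : R) (y : V) : 0 <= Rad ->
  exists2 z, enorm z <= Rad &
    forall x, enorm x <= Rad -> dotv (z - x) (z - x) <= dotv (y - x) (y - x).
Proof.
move=> Rad0; have [yR|yR] := leP (enorm y) Rad; first by exists y.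
have y0 : 0 < enorm y by rewrite (le_lt_trans Rad0).
pose al := Rad / enorm y.
have aly : al * enorm y = Rad by rewrite mulrVK// unitfE gt_eqF.
have al0 : 0 <= al by rewrite divr_ge0// ltW.
have al1 : al < 1 by rewrite ltr_pdivrMr// mul1r.
exists (al *: y); first by rewrite enormZ ger0_norm// aly.
move=> x xR; rewrite !(dotvBl, dotvBr, dotvZl, dotvZr) (dotvC y x).
have := cauchy_schwarz x y.
have : enorm x * enorm y <= al * enorm y * enorm y.
  by rewrite ler_wpM2r ?enorm_ge0// aly.
rewrite -mulrA -expr2 enorm_sqr => h1 h2.
(* The difference of the two squared distances is this term plus [(1 - al) ^+ 2 * dotv y y]. *)
have {h1 h2} : 0 <= 2 * (1 - al) * (al * dotv y y - dotv x y).
  by rewrite !mulr_ge0//; lra.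
have := dotvv_ge0 y; move: (dotv y y) (dotv x y) (dotv x x) => p q r p0 h.
have : 0 <= (1 - al) * (1 - al) * p by rewrite !mulr_ge0//; lra.
nra.
Qed.

(** The potential is the squared distance from the iterate [x0] to [x]. A step along [- p.2] changes
    it by [- 2 * gam * dotv p.2 (x0 - x)] plus a quadratic term, and [dotv p.2 (p.1 - x)] differs
    from [dotv p.2 (x0 - x)] by at most [eta]. The cuts are chosen from the iterates alone, so one
    list serves all [x]. *)
Lemma online_gradient (Rad eta G gam : R) (h : seq (V * V)) (K : nat) :
  0 <= Rad -> 0 < gam ->
  (forall p, p \in h -> enorm p.2 <= G) ->
  (forall x, enorm x <= Rad ->
    exists2 p, p \in h & dotv p.2 (p.1 - x) <= eta) ->
  exists ps : seq (V * V), exists2 x0 : V,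
    [/\ size ps = K, {subset ps <= h} & enorm x0 <= Rad] &
    forall x, enorm x <= Rad ->
      2 * gam * \sum_(p <- ps) dotv p.2 (p.1 - x) + dotv (x0 - x) (x0 - x) <=
      dotv x x + K%:R * (gam ^+ 2 * G ^+ 2 + 2 * gam * eta).
Proof.
move=> Rad0 gam0 hG hcov; elim: K => [|K [ps [x0 [sps psh x0R] H]]].
  exists [::]; exists 0; first by split => //; rewrite enorm0.
  by move=> x _; rewrite big_nil mulr0 sub0r dotvNl dotvNr opprK mul0r addr0
    add0r.
have [p ph peta] := hcov x0 x0R.
have [z zR Hz] := ball_projection (x0 - gam *: p.2) Rad0.
exists (p :: ps); exists z.
  split => //; first by rewrite /= sps.
  by move=> q; rewrite inE => /orP[/eqP->//|/psh].
move=> x xR; rewrite big_cons.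
have := H x xR; have := Hz x xR.
have -> : x0 - gam *: p.2 - x = (x0 - x) - gam *: p.2 by rewrite addrAC.
rewrite !(dotvBl _ (gam *: _)) !(dotvBr _ _ (gam *: _)) !(dotvZl, dotvZr).
rewrite (dotvC _ p.2).
have -> : dotv p.2 (p.1 - x) = dotv p.2 (p.1 - x0) + dotv p.2 (x0 - x).
  by rewrite -dotvDr addrA subrK.
have : gam * (gam * dotv p.2 p.2) <= gam ^+ 2 * G ^+ 2.
  rewrite mulrA -expr2 ler_wpM2l ?sqr_ge0// -enorm_sqr.
  rewrite ler_pXn2r ?nnegrE ?enorm_ge0//; first exact: hG.
  exact: le_trans (enorm_ge0 _) (hG _ ph).
have : gam * dotv p.2 (p.1 - x0) <= gam * eta by rewrite ler_pM2l.
have -> : K.+1%:R = K%:R + 1 :> R by rewrite natr1.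
move: (dotv (z - x) _) (dotv (x0 - x) (x0 - x)) (dotv p.2 _) (dotv p.2 _) (gam
  * (gam * _)).
move=> A B C D E; lra.
Qed.

(* Online gradient descent against an adversary that answers the iterate [x]
  with
   a cut [p] such that [dotv p.2 (p.1 - x) <= eta]. *)
Lemma certificate (Rad eta G : R) (h : seq (V * V)) :
  0 <= Rad -> 0 < eta -> 0 < G ->
  (forall p, p \in h -> enorm p.2 <= G) ->
  (forall x, enorm x <= Rad ->
    exists2 p, p \in h & dotv p.2 (p.1 - x) <= eta) ->
  exists2 ps : seq (V * V), (0 < size ps)%N /\ {subset ps <= h} &
    forall x, enorm x <= Rad ->
      \sum_(p <- ps) dotv p.2 (p.1 - x) <= (size ps)%:R * (2 * eta).
Proof.
move=> Rad0 eta0 G0 hG hcov.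
(* This step size makes the quadratic term [gam * eta]. With [K * gam * eta >= Rad ^+ 2] the total
   is at most [4 * K * gam * eta], that is [2 * eta] per cut after division by [2 * gam]. *)
pose gam := eta / G ^+ 2.
have gam0 : 0 < gam by rewrite divr_gt0// exprn_gt0.
have gG : gam ^+ 2 * G ^+ 2 = gam * eta.
  by rewrite /gam; field; rewrite gt_eqF.
pose K := (Num.bound (Rad ^+ 2 / (gam * eta))).+1.
have KR : Rad ^+ 2 <= K%:R * (gam * eta).
  have q0 : 0 <= Rad ^+ 2 / (gam * eta) by rewrite divr_ge0 ?sqr_ge0// mulr_ge0
    ?ltW.
  rewrite -ler_pdivrMr; last exact: mulr_gt0.
  apply: (le_trans (ltW (archi_boundP q0))).
  by rewrite ler_nat /K leqnSn.
have [ps [x0 [sps psh _] H]] := online_gradient K Rad0 gam0 hG hcov.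
exists ps; first by rewrite sps.
move=> x xR; have := H x xR; have := dotvv_ge0 (x0 - x).
have : dotv x x <= Rad ^+ 2 by rewrite -enorm_sqr ler_pXn2r ?nnegrE ?enorm_ge0.
rewrite gG sps; set S := \sum_(_ <- _) _ => h1 h2 h3.
rewrite -(ler_pM2l (_ : 0 < 2 * gam)); last by lra.
rewrite (_ : 2 * gam * (K%:R * (2 * eta)) = 4 * (K%:R * (gam * eta)));
  last by ring.
lra.
Qed.

End OnlineGradient.

(** * From the recorded cuts to an almost optimal point *)

Section Output.
Context (R : realType) (d : nat).
Local Notation V := 'rV[R]_d.

(** Repetitions in [ps] encode rational weights. The condition mentions the recorded history but not
    [f], so the output can be chosen from the history. *)
Definition certified (Rad eta : R) (h : seq (V * V)) (z : V) : Prop :=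
  exists ps : seq (V * V),
    [/\ (0 < size ps)%N, {subset ps <= h},
        z = (size ps)%:R^-1 *: \sum_(p <- ps) p.1 &
        forall x, enorm x <= Rad ->
          \sum_(p <- ps) dotv p.2 (p.1 - x) <= (size ps)%:R * (2 * eta)].

Definition cp_output (Rad eta : R) (h : seq (V * V)) : V :=
  xget 0 (certified Rad eta h).

(** Jensen's inequality: the tangent plane at the average lies below [f], and its linear terms
    cancel in the sum. *)
Lemma convex_average_le (f : V -> R) (ps : seq V) :
  (forall x, differentiable f x) ->
  convex_function (E := 'rV[R]_d) setT f ->
  (0 < size ps)%N ->
  (size ps)%:R * f ((size ps)%:R^-1 *: \sum_(p <- ps) p) <= \sum_(p <- ps) f p.
Proof.
move=> df cf ps0; set z := _ *: _.
have n0 : (size ps)%:R != 0 :> R by rewrite pnatr_eq0 -lt0n.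
have : \sum_(p <- ps) (f z + dotv (grad f z) (p - z)) <= \sum_(p <- ps) f p.
  by apply: ler_sum => p _; exact: convex_grad_le.
rewrite big_split /= big_const_seq count_predT iter_addr_0.
have -> : \sum_(p <- ps) dotv (grad f z) (p - z) =
    dotv (\sum_(p <- ps) (p - z)) (grad f z).
  by rewrite dotv_suml; apply: eq_bigr => p _; rewrite dotvC.
have -> : \sum_(p <- ps) (p - z) = 0.
  rewrite big_split /= big_const_seq count_predT iter_addr_0 mulNrn -scaler_nat.
  by rewrite /z scalerA divff// scale1r subrr.
by rewrite dot0v addr0 mulr_natl.
Qed.

(** Replacing the gradient at a query by the recorded cut costs [nu] times the distance from the
    query to [xs], at most [2 * Rad + Rad]. *)
Lemma cp_output_le (f : V -> R) (Rad eta nu G : R) (h : seq (V * V)) (xs : V) :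
  (forall x, differentiable f x) ->
  convex_function (E := 'rV[R]_d) setT f ->
  0 <= Rad -> 0 < eta -> 0 < G -> 0 <= nu -> enorm xs <= Rad ->
  (forall p, p \in h -> [/\ enorm p.2 <= G, enorm p.1 <= 2 * Rad &
     enorm (p.2 - grad f p.1) <= nu]) ->
  (forall x, enorm x <= Rad ->
    exists2 p, p \in h & dotv p.2 (p.1 - x) <= eta) ->
  f (cp_output Rad eta h) <= f xs + (2 * eta + 3 * Rad * nu).
Proof.
move=> df cf Rad0 eta0 G0 nu0 xsR hp hcov.
have hG p : p \in h -> enorm p.2 <= G by case/hp.
have : certified Rad eta h (cp_output Rad eta h).
  have [ps [ps0 psh] H] := certificate Rad0 eta0 G0 hG hcov.
  apply: (@xgetPex _ 0); exists ((size ps)%:R^-1 *: \sum_(p <- ps) p.1).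
  by exists ps.
move=> [ps [ps0 psh -> H]].
have n0 : 0 < (size ps)%:R :> R by rewrite ltr0n.
rewrite -(ler_pM2l n0).
have -> : \sum_(p <- ps) p.1 = \sum_(c <- map fst ps) c by rewrite big_map.
have := @convex_average_le f (map fst ps) df cf.
rewrite !size_map => /(_ ps0) /le_trans; apply.
rewrite big_map mulrDr mulrDr.
have : \sum_(p <- ps) f p.1 <=
    \sum_(p <- ps) (f xs + dotv p.2 (p.1 - xs) + 3 * Rad * nu).
  rewrite big_seq [leRHS]big_seq; apply: ler_sum => p /psh ph.
  have [_ p1 p2] := hp p ph.
  have := convex_grad_le xs (df p.1) cf.
  have := cauchy_schwarz (grad f p.1 - p.2) (p.1 - xs).
  have : enorm (grad f p.1 - p.2) * enorm (p.1 - xs) <= nu * (3 * Rad).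
    apply: ler_pM; rewrite ?enorm_ge0//; first by rewrite enormBC.
    by rewrite (le_trans (ler_enormB _ _))//; lra.
  rewrite !(dotvBl, dotvBr); lra.
rewrite !big_split /= !big_const_seq !count_predT !iter_addr_0 !mulr_natl.
have := H xs xsR; rewrite !mulr_natl; lra.
Qed.

(** The search runs in the ball of radius [2 * Rad] so that a ball of radius [r <= Rad] around any
    candidate of norm at most [Rad] fits into it. Cuts have norm at most [L + nu]. *)
Lemma cutting_plane_optimal (f : V -> R) (L Rad eps eta nu r : R) (gs : seq V) :
  sco_objective L Rad f -> 0 <= L ->
  0 < r -> r <= Rad -> 0 < eta -> 0 < nu ->
  r * (L + nu) <= eta -> 2 * eta + 3 * Rad * nu <= eps ->
  (1 - gain R) ^+ size gs * (2 * Rad) ^+ d < r ^+ d ->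
  (forall k, (k < size gs)%N ->
    enorm (nth 0 gs k - grad f (next_center (2 * Rad) (hist (2 * Rad) (take k
      gs))))
      <= nu) ->
  eps_optimal f eps (cp_output Rad eta (hist (2 * Rad) gs)).
Proof.
move=> [df cf Lf [xs [xsmin xsR]]] L0 r0 rRad eta0 nu0 rL epsE vol Hgs.
have Rad0 : 0 <= Rad by lra.
have Rad20 : 0 <= 2 * Rad by lra.
have hE p : p \in hist (2 * Rad) gs -> exists2 k, (k < size gs)%N &
    p = (next_center (2 * Rad) (hist (2 * Rad) (take k gs)), nth 0 gs k).
  move=> /(nthP (0, 0))[k]; rewrite size_hist => kn <-.
  by exists k => //; rewrite nth_hist.
have gL k : (k < size gs)%N -> enorm (nth 0 gs k) <= L + nu.
  move=> kn; have := Hgs k kn; set c := next_center _ _ => h1.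
  have -> : nth 0 gs k =
    grad f c + (nth 0 gs k - grad f c) by rewrite addrC subrK.
  rewrite (le_trans (ler_enormD _ _))// lerD//.
  exact: enorm_grad_le.
have xsinf : f xs <= inf (range f).
  by apply: lb_le_inf; [exists (f 0); exists 0|move=> _ [y _ <-]; exact: xsmin].
rewrite /eps_optimal (le_trans (_ : _ <= f xs + eps)) ?lerD2r//.
apply: le_trans (_ : f xs + (2 * eta + 3 * Rad * nu) <= _);
  last by rewrite lerD2l.
apply: (@cp_output_le _ _ _ _ (L + nu)) => //; rewrite ?ltW//; first by lra.
  move=> p /hE[k kn ->] /=; split;
    [exact: gL|exact: next_center_ball|exact: Hgs].
move=> x xR; apply: (@cutting_plane_cover _ _ _ _ r _ (L + nu)) => //.
  by move=> g /(nthP 0)[k kn <-]; exact: gL.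
by lra.
Qed.

End Output.

(** * Algorithms with a countable memory *)

Section NatMemory.
Local Open Scope ereal_scope.
Context (R : realType).

Lemma measurable_fun_nat (disp : measure_display) (T : measurableType disp)
    (phi : T -> nat) (disp' : measure_display) (U : measurableType disp')
    (h : nat -> U) :
  measurable_fun setT phi -> measurable_fun setT (fun y => h (phi y)).
Proof. by move=> mphi; apply: (@measurableT_comp _ _ _ _ _ _ h). Qed.

Lemma ge0_integral_nat_comp (disp : measure_display) (T : measurableType disp)
    (mu : {measure set T -> \bar R}) (phi : T -> nat) (h : nat -> \bar R) :
  measurable_fun setT phi -> (forall k, 0 <= h k) ->
  \int[mu]_y h (phi y) = \sum_(k <oo) h k * mu [set y | phi y = k].
Proof.
move=> mphi h0.
have mk k : measurable [set y | phi y = k].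
  by rewrite -[X in measurable X]setTI; apply: (mphi _ [set k]).
have UT : \bigcup_k [set y | phi y = k] = [set: T].
  by apply/seteqP; split => // y _; exists (phi y).
rewrite -UT ge0_integral_bigcup//; first last.
- apply/trivIsetP => i j _ _ /eqP ij; apply/seteqP; split => // y [/= ->].
  by move/ij.
- by rewrite UT; exact: measurable_fun_nat.
apply: eq_eseriesr => k _.
rewrite (eq_integral (cst (h k))) ?integral_cst// => x.
by rewrite inE => ->.
Qed.

Context (d : nat).
Local Notation V := (borel_rV R d).
Variables (qry : nat -> V) (upd : nat * V -> nat) (out : nat -> V) (m0 : nat).
Hypotheses (mq : measurable_fun setT qry) (mu : measurable_fun setT upd)
  (mo : measurable_fun setT out).

Definition nat_algorithm : algorithm R d :=
  @Algorithm R d _ nat (\d_m0 : probability nat R) qry upd out mq mu mo.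

Variable orc : R.-pker V ~> V.

Definition nat_step (h : nat -> \bar R) (m : nat) : \bar R :=
  \int[orc (qry m)]_y h (upd (m, y)).

Lemma nat_step_ge0 h : (forall k, 0 <= h k) -> forall m, 0 <= nat_step h m.
Proof. by move=> h0 m; apply: integral_ge0. Qed.

Lemma measurable_upd m : measurable_fun setT (fun y => upd (m, y)).
Proof. exact: (measurableT_comp mu (measurable_pair1 m)). Qed.

Lemma nat_stepE h m : (forall k, 0 <= h k) ->
  nat_step h m = \sum_(k <oo) h k * orc (qry m) [set y | upd (m, y) = k].
Proof.
by move=> h0; apply: ge0_integral_nat_comp => //; exact: measurable_upd.
Qed.

(** Pushing the law forward is dual to pulling the test function back. On a countable memory both
    are series of nonnegative terms, which may be exchanged. *)
Lemma integral_mem_law (N : nat) h : (forall k, 0 <= h k) ->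
  \int[mem_law nat_algorithm orc N]_k h k = iter N nat_step h m0.
Proof.
elim: N h => [|N ih] h h0.
  by rewrite /= integral_dirac// diracT mul1e.
rewrite iterSr -ih; last exact: nat_step_ge0.
rewrite (@ge0_integral_nat_comp _ nat _ id)//=.
rewrite (eq_integral (fun m => \sum_(k <oo) h k * orc (qry m) [set y | upd (m,
  y) = k])); last first.
  by move=> m _; exact: nat_stepE.
rewrite integral_nneseries//; last first.
  by move=> k m _; rewrite mule_ge0.
apply: eq_eseriesr => k _; rewrite ge0_integralZl//.
Qed.

End NatMemory.

(** * Rounding answers to a grid *)

Section Rounding.
Context (R : realType) (d : nat).
Local Notation V := 'rV[R]_d.
Local Notation Z := 'rV[int]_d.

Definition rnd (dl : R) (y : V) : Z := \row_i Num.floor (y 0 i / dl).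

Definition unrnd (dl : R) (z : Z) : V := \row_i (dl * (z 0 i)%:~R).

Lemma rnd_error (dl : R) (y : V) : 0 < dl ->
  enorm (unrnd dl (rnd dl y) - y) ^+ 2 <= d%:R * dl ^+ 2.
Proof.
move=> dl0; rewrite enorm_sqr /dotv.
apply: (@le_trans _ _ (\sum_(i < d) dl ^+ 2)); last first.
  by rewrite sumr_const card_ord mulr_natl.
apply: ler_sum => i _; rewrite -expr2 !mxE.
set t := y 0 i / dl; have -> : y 0 i = dl * t.
  by rewrite /t mulrCA divff ?mulr1// gt_eqF.
rewrite -mulrBr exprMn ler_piMr ?sqr_ge0//.
have := floor_le_tmp t; have := floorD1_gt t; rewrite intrD.
move: (_%:~R) => f; nra.
Qed.

Lemma measurable_coord_lt (i : 'I_d) (a : R) :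
  @measurable _ (borel_rV R d) [set y : V | y 0 i < a].
Proof.
apply: sub_sigma_algebra.
have -> : [set y : V | y 0 i < a] =
  (fun y : V => y 0 i) @^-1` [set x | x < a] by [].
by apply: open_comp; [move=> x _; exact: coord_continuous|exact: open_lt].
Qed.

(** Each fiber is a grid cell, a finite intersection of half-open slabs. *)
Lemma measurable_pickle_rnd (dl : R) : 0 < dl ->
  measurable_fun setT (fun y : borel_rV R d => pickle (rnd dl y)).
Proof.
move=> dl0 _ Y _; rewrite setTI.
have -> : (fun y : borel_rV R d => pickle (rnd dl y)) @^-1` Y =
    \bigcup_(k in Y) [set y | pickle (rnd dl y) = k].
  apply/seteqP; split => [y Yy|y [k Yk /= yk]];
    first by exists (pickle (rnd dl y)).
  by rewrite /preimage /= yk.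
apply: bigcup_measurable => k _.
have [[z zk]|nz] := pselect (exists z : Z, pickle z = k); last first.
  have -> : [set y | pickle (rnd dl y) = k] = set0 => //.
  by apply/seteqP; split => // y /= yk; apply: nz; exists (rnd dl y).
have -> : [set y | pickle (rnd dl y) = k] =
    \bigcap_(i in [set: 'I_d]) ([set y : V | y 0 i < dl * (z 0 i + 1)%:~R] `&`
       ~` [set y : V | y 0 i < dl * (z 0 i)%:~R]).
  apply/seteqP; split => y /=.
    rewrite -zk => /(pcan_inj pickleK) <- i _ /=; rewrite mxE.
    split; first by rewrite -ltr_pdivrMl// mulrC floorD1_gt.
    by apply/negP; rewrite -leNgt -ler_pdivlMl// mulrC floor_le_tmp.
  move=> H; rewrite -zk; congr pickle; apply/rowP => i; rewrite mxE.
  have [/= h1 /negP h2] := H i I; apply: floor_def.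
  by rewrite ler_pdivlMr// ltr_pdivrMr// mulrC leNgt h2 /= mulrC.
apply: fin_bigcap_measurable; first exact: finite_finset.
move=> i _; apply: measurableI; first exact: measurable_coord_lt.
by apply: measurableC; exact: measurable_coord_lt.
Qed.

(** A number that codes nothing is read as the empty transcript; runs only visit genuine codes. *)
Definition transcript (m : nat) : seq Z := odflt [::] (unpickle m).

Lemma transcriptK : cancel (@pickle (seq Z)) transcript.
Proof. by move=> s; rewrite /transcript pickleK. Qed.

Definition record (dl : R) (my : nat * borel_rV R d) : nat :=
  pickle (rcons (transcript my.1) (rnd dl my.2)).

Lemma measurable_rnd_fun (dl : R) (disp : measure_display)
    (U : measurableType disp) (h : Z -> U) : 0 < dl ->
  measurable_fun setT (fun y : borel_rV R d => h (rnd dl y)).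
Proof.
move=> dl0.
have -> : (fun y : borel_rV R d => h (rnd dl y)) =
    (fun y => (h \o odflt 0 \o unpickle) (pickle (rnd dl y))).
  by apply/funext => y /=; rewrite pickleK.
by apply: measurable_fun_nat; exact: measurable_pickle_rnd.
Qed.

Lemma measurable_record (dl : R) : 0 < dl -> measurable_fun setT (record dl).
Proof.
move=> dl0 _ Y mY; rewrite setTI.
have -> : record dl @^-1` Y = \bigcup_m ([set m] `*`
    [set y | Y (pickle (rcons (transcript m) (rnd dl y)))]).
  apply/seteqP; split => [[m y] Ymy|[m y] [k _ [/= -> //]]].
  by exists m.
apply: bigcup_measurable => m _; apply: measurableX => //.
have := @measurable_rnd_fun dl _ nat
  (fun z => pickle (rcons (transcript m) z)) dl0 measurableT Y mY.
by rewrite setTI.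
Qed.

End Rounding.

(** * Robust mean estimation *)

Section OneStep.
Context (R : realType) (d : nat).
Local Notation V := 'rV[R]_d.
Implicit Types (S u e : V).

(** Here [S] is the accumulated error, [u] the fresh noise and [e] the rounding error. The product
    of [S] and [u] is kept exact because its mean vanishes; that of [S] and [e] is split by Young's
    inequality with a small weight [ka] on [S]. *)
Lemma sqr_dist_le S u e (ka : R) : 0 < ka ->
  dotv (S + u + e) (S + u + e) <=
  (1 + ka) * dotv S S + 2 * dotv S u + 2 * dotv u u + (ka^-1 + 2) * dotv e e.
Proof.
move=> ka0.
have h1 : 0 <= ka * dotv (S - ka^-1 *: e) (S - ka^-1 *: e).
  by rewrite mulr_ge0 ?dotvv_ge0// ltW.
have E : ka * dotv (S - ka^-1 *: e) (S - ka^-1 *: e) =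
    ka * dotv S S - 2 * dotv S e + ka^-1 * dotv e e.
  by rewrite !(dotvBl, dotvBr, dotvZl, dotvZr) (dotvC e S); field;
    rewrite gt_eqF.
move: h1; rewrite {}E; have := dotvv_ge0 (u - e).
rewrite !(dotvBl, dotvBr, dotvDl, dotvDr).
rewrite (dotvC e S) (dotvC u S) (dotvC e u).
lra.
Qed.

Local Open Scope ereal_scope.

(** The integrand is dominated by [U], whose linear part [f1] has mean zero and whose quadratic part
    [f2] is the variance. The affine form [a + b * _] lets the bound be iterated. *)
Lemma one_step (mu : {measure set (borel_rV R d) -> \bar R}) (g S : V)
    (sigma dl ka a b : R) :
  mu setT = 1 ->
  (forall i : 'I_d, mu.-integrable setT (fun y : borel_rV R d => ((y : V) 0%R
    i)%:E) /\
     \int[mu]_y ((y : V) 0%R i)%:E = (g 0%R i)%:E) ->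
  \int[mu]_y (enorm ((y : V) - g) ^+ 2)%:E <= (sigma ^+ 2)%:E ->
  (0 < dl)%R -> (0 < ka)%R -> (0 <= a)%R -> (0 <= b)%R ->
  \int[mu]_y (a + b * enorm (S + (unrnd dl (rnd dl (y : V)) - g)) ^+ 2)%:E <=
  (a + b * ((1 + ka) * enorm S ^+ 2 + 2 * sigma ^+ 2 +
     (ka^-1 + 2) * (d%:R * dl ^+ 2)))%:E.
Proof.
move=> mu1 mom1 mom2 dl0 ka0 a0 b0.
pose c0 : R := (a + b * ((1 + ka) * enorm S ^+ 2 + (ka^-1 +
  2) * (d%:R * dl ^+ 2)))%R.
pose f1 (y : borel_rV R d) : \bar R :=
  \sum_(i < d) (2 * b * S 0 i)%:E * (((y : V) 0%R i)%:E - (g 0%R i)%:E).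
pose f2 (y : borel_rV R d) : \bar R := (enorm ((y : V) - g) ^+ 2)%:E.
have intc (c : R) : \int[mu]_y c%:E = c%:E.
  by rewrite integral_cst// mu1 mule1.
have icst (c : R) : mu.-integrable setT (cst c%:E).
  by apply/integrableP; split => //=; rewrite intc ltry.
have id i : mu.-integrable setT (fun y : borel_rV R d => ((y : V) 0%R i)%:E -
  (g 0%R i)%:E).
  by apply: integrableB => //; [case: (mom1 i)|exact: icst].
have if1 : mu.-integrable setT f1.
  apply: (@integrable_sum _ _ _ mu setT measurableT _ _ _ (fun i (y : borel_rV
    R d) => (2 * b * S 0 i)%:E * (((y : V) 0%R i)%:E - (g 0%R i)%:E))).
  by move=> i _; apply: integrableZl.
have int1 : \int[mu]_y f1 y = 0.
  rewrite integral_sum//; last by move=> i; apply: integrableZl.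
  apply: big1 => i _; rewrite integralZl// integralB//;
    [|by case: (mom1 i)|exact: icst].
  by rewrite (mom1 i).2 intc subee// mule0.
have mf2 : measurable_fun setT f2.
  apply/measurable_EFinP.
  have -> : (fun y : borel_rV R d => enorm ((y : V) - g) ^+ 2)%R =
      (fun y : borel_rV R d => \sum_(i < d) ((y : V) 0 i - g 0 i) ^+ 2)%R.
    apply/funext => y; rewrite enorm_sqr /dotv; apply: eq_bigr => i _.
    by rewrite !mxE expr2.
  apply: measurable_sum => i; apply: measurable_funX;
    apply: measurable_funB => //.
  by apply/measurable_EFinP; case: (mom1 i) => /integrableP[].
have f20 y : 0 <= f2 y by rewrite lee_fin sqr_ge0.
have if2 : mu.-integrable setT f2.
  apply/integrableP; split => //.
  under eq_integral do rewrite gee0_abs//.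
  by rewrite (le_lt_trans mom2)// ltry.
pose U y := c0%:E + f1 y + (2 * b)%:E * f2 y.
have UE (y : borel_rV R d) : U y =
  (c0 + 2 * b * dotv S ((y : V) - g) +
  2 * b * dotv ((y : V) - g) ((y : V) - g))%:E.
  rewrite /U /f1 /f2 enorm_sqr -EFinM !EFinD; congr (_ + _ + _).
  rewrite /dotv mulr_sumr -sumEFin; apply: eq_bigr => i _.
  by rewrite -EFinB -EFinM !mxE mulrA.
have LU (y : borel_rV R d) : (a + b * enorm (S +
  (unrnd dl (rnd dl (y : V)) - g)) ^+ 2)%:E <= U y.
  rewrite UE lee_fin /c0.
  have := @sqr_dist_le S ((y : V) - g) (unrnd dl (rnd dl (y : V)) - (y : V)) ka
    ka0.
  have -> : (S + (y - g) + (unrnd dl (rnd dl y) - y) =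
    S + (unrnd dl (rnd dl y) - g))%R.
    by rewrite -addrA; congr (_ + _)%R; rewrite addrC addrA subrK.
  have := rnd_error (y : V) dl0.
  rewrite !enorm_sqr.
  set A := dotv _ _; set B := dotv (S + _) _; move=> h1 h2.
  have k0 : (0 <= ka^-1 + 2)%R by rewrite addr_ge0// invr_ge0 ltW.
  have h3 := ler_wpM2l k0 h1;
    have h4 := ler_wpM2l b0 (le_trans h2 (lerD (lexx _) h3)).
  lra.
apply: (@le_trans _ _ (\int[mu]_y U y)).
  apply: ge0_le_integral => //.
  - by move=> y _; rewrite lee_fin addr_ge0// mulr_ge0// sqr_ge0.
  - by apply: (@measurable_rnd_fun R d dl _ _ (fun z => (a + b * enorm (S +
    (unrnd dl z - g)) ^+ 2)%:E)).
  - apply: emeasurable_funD; first apply: emeasurable_funD => //.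
      by case/integrableP: if1.
    exact: measurable_funeM.
rewrite integralD//; [|by apply: integrableD => //;
  exact: icst|by apply: integrableZl].
rewrite [X in X + _]integralD//; last exact: icst.
rewrite int1 adde0 intc integralZl//.
have : (2 * b)%:E * \int[mu]_y f2 y <= (2 * b)%:E * (sigma ^+ 2)%:E.
  by apply: lee_wpmul2l => //; rewrite lee_fin mulr_ge0.
move=> /(leeD2l c0%:E) /le_trans; apply.
rewrite -EFinM -EFinD lee_fin /c0; lra.
Qed.

End OneStep.

(** * Conditional expectations along a transcript *)

Section Transcripts.
Context (R : realType) (d : nat).
Local Notation V := 'rV[R]_d.
Local Notation Z := 'rV[int]_d.
Variables (orc : R.-pker (borel_rV R d) ~> (borel_rV R d)) (gr : V -> V).
Variables (sigma dl : R) (q : seq Z -> V).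
Hypothesis moment1 : forall (x : V) (i : 'I_d),
  (orc x).-integrable setT (fun y : borel_rV R d => ((y : V) 0 i)%:E) /\
  (\int[orc x]_y ((y : V) 0 i)%:E)%E = (gr x 0 i)%:E.
Hypothesis moment2 : forall x : V,
  (\int[orc x]_y (enorm ((y : V) - gr x) ^+ 2)%:E <= (sigma ^+ 2)%:E)%E.
Hypothesis dl0 : 0 < dl.

(** Conditional expectation of [h] after one more query, given the transcript [s]; its iterates are
    the conditional expectations after several queries. *)
Definition exp1 (h : seq Z -> \bar R) (s : seq Z) : \bar R :=
  (\int[orc (q s)]_y h (rcons s (rnd dl (y : V))))%E.

Lemma exp1_ge0 h : (forall s, 0 <= h s)%E -> forall s, (0 <= exp1 h s)%E.
Proof. by move=> h0 s; apply: integral_ge0. Qed.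

Lemma exp1_le h1 h2 s : (forall s, 0 <= h1 s)%E ->
  (forall z, h1 (rcons s z) <= h2 (rcons s z))%E -> (exp1 h1 s <= exp1 h2 s)%E.
Proof.
move=> h10 h12; apply: ge0_le_integral => //.
- exact: (@measurable_rnd_fun R d dl _ _ (fun z => h1 (rcons s z))).
- exact: (@measurable_rnd_fun R d dl _ _ (fun z => h2 (rcons s z))).
Qed.

Lemma expn_ge0 k h : (forall s, 0 <= h s)%E ->
  forall s, (0 <= iter k exp1 h s)%E.
Proof. by move=> h0; elim: k => //= k ih; exact: exp1_ge0. Qed.

Lemma expn_le k h1 h2 s : (forall s, 0 <= h1 s)%E ->
  (forall w, size w = k -> h1 (s ++ w) <= h2 (s ++ w))%E ->
  (iter k exp1 h1 s <= iter k exp1 h2 s)%E.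
Proof.
move=> h10; elim: k s => [|k ih] s h12.
  by have := h12 [::] erefl; rewrite cats0.
rewrite !iterS; apply: exp1_le; first exact: expn_ge0.
move=> z; apply: ih => w wk; rewrite cat_rcons; apply: h12.
by rewrite /= wk.
Qed.

Section Block.
Variables (n : nat) (x : V).
Hypotheses (n0 : (0 < n)%N) (ndl : (n%:R + 2) * (d%:R * dl ^+ 2) <= sigma ^+ 2).

(* The rounding bias is absorbed by Young's inequality, at the price of the
   growth factor [(1 + 1/n)^j <= e]. *)
Lemma block_moment (s : seq Z) (a b : R) :
  (forall w, (size w < n)%N -> q (s ++ w) = x) -> 0 <= a -> 0 <= b ->
  forall j w, (size w + j = n)%N ->
  (iter j exp1 (fun s' =>
     (a + b * enorm (\sum_(z <- drop (size s) s') (unrnd dl z - gr x)) ^+ 2)%:E)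
     (s ++ w) <=
   (a + b * ((1 + n%:R^-1) ^+ j *
     (enorm (\sum_(z <- w) (unrnd dl z - gr x)) ^+ 2 +
       j%:R * (3 * sigma ^+ 2))))%:E)%E.
Proof.
move=> sx a0 b0; have ka0 : 0 < n%:R^-1 :> R by rewrite invr_gt0 ltr0n.
have k1 j : 0 <= (1 + n%:R^-1) ^+ j :> R by rewrite exprn_ge0// addr_ge0// ltW.
have s2 := sqr_ge0 sigma.
elim=> [|j ih] w wj.
  by rewrite /= drop_size_cat// expr0 mul1r mul0r addr0.
rewrite iterS.
set S := \sum_(z <- w) _.
set K := (1 + n%:R^-1 : R) ^+ j.
pose h2 (s' : seq Z) : \bar R := ((a + b * K * (j%:R * (3 * sigma ^+ 2))) +
  (b * K) *
   enorm (\sum_(z <- drop (size s) s') (unrnd dl z - gr x)) ^+ 2)%:E.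
apply: (@le_trans _ _ (exp1 h2 (s ++ w))).
  apply: exp1_le.
    by apply: expn_ge0 => s'; rewrite lee_fin addr_ge0// mulr_ge0// sqr_ge0.
  move=> z; rewrite -cats1 -catA cats1; apply: (le_trans (ih _ _)).
    by rewrite size_rcons addSnnS.
  rewrite /h2 drop_size_cat// lee_fin -/K; lra.
rewrite /exp1 sx; last by rewrite -wj addnS ltnS leq_addr.
have hE (y : V) : h2 (rcons (s ++ w) (rnd dl y)) =
    ((a + b * K * (j%:R * (3 * sigma ^+ 2))) + (b * K) *
     enorm (S + (unrnd dl (rnd dl y) - gr x)) ^+ 2)%:E.
  by rewrite /h2 -cats1 -catA drop_size_cat// big_cat /= big_seq1.
under eq_integral do rewrite hE.
have K0 : 0 <= K by exact: k1.
have KK0 : 0 <= b * K by rewrite mulr_ge0.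
have mu1 : orc x setT = 1%E by exact: prob_kernel.
apply: (le_trans (one_step S mu1 (moment1 x) (moment2 x) dl0 ka0 _ KK0)).
  by rewrite addr_ge0// mulr_ge0// mulr_ge0// mulr_ge0.
rewrite lee_fin invrK [_ ^+ j.+1]exprS -/K -[j.+1%:R]natr1.
(* With [ka] the inverse of [n], the rounding factor is [n + 2]; by [ndl] rounding adds at most
   [sigma ^+ 2] to the [2 * sigma ^+ 2] of the noise, whence [3 * sigma ^+ 2] per answer. *)
have := ler_wpM2l KK0 ndl.
have : 0 <= n%:R^-1 * (b * K * ((j%:R + 1) * (3 * sigma ^+ 2))).
  apply: mulr_ge0; first exact: ltW.
  apply: mulr_ge0; first exact: KK0.
  apply: mulr_ge0; [by rewrite addr_ge0|lra].
move: (n%:R^-1 : R) (sigma ^+ 2) (n%:R : R) (d%:R * _) (enorm S ^+ 2) (j%:R :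
  R) => u v p r e t.
lra.
Qed.

Lemma growth_le_exp : (1 + n%:R^-1) ^+ n <= expR 1 :> R.
Proof.
have n1 : n%:R != 0 :> R by rewrite pnatr_eq0 -lt0n.
have -> : expR 1 = (expR n%:R^-1) ^+ n :> R.
  by rewrite -expRM_natl mulfV.
by rewrite lerXn2r ?nnegrE ?expR_ge0 ?addr_ge0 ?invr_ge0// expR_ge1Dx.
Qed.

Definition block_mean (w : seq Z) : V := n%:R^-1 *: \sum_(z <- w) unrnd dl z.

Definition bad_block (rho : R) (w : seq Z) : bool :=
  ~~ (enorm (block_mean w - gr x) <= rho).

(** Chebyshev's inequality: the summed error has second moment at most
    [expR 1 * n * 3 * sigma ^+ 2], while a bad block needs more than [(n * rho) ^+ 2]. The constant
    [48 = 3 * 16] makes the ratio at most [1 / 16]. *)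
Lemma block_bad (rho : R) (s : seq Z) (a b : R) :
  0 < rho -> 48 * expR 1 * sigma ^+ 2 <= n%:R * rho ^+ 2 ->
  (forall w, (size w < n)%N -> q (s ++ w) = x) -> 0 <= a -> 0 <= b ->
  (iter n exp1 (fun s' => (a +
    b * (bad_block rho (drop (size s) s'))%:R)%:E) s <=
   (a + b / 16)%:E)%E.
Proof.
move=> rho0 big_n sx a0 b0.
have nR : 0 < n%:R :> R by rewrite ltr0n.
pose c := (n%:R * rho) ^+ 2.
have c0 : 0 < c by rewrite exprn_gt0// mulr_gt0.
pose h2 (s' : seq Z) : \bar R := (a + b / c *
  enorm (\sum_(z <- drop (size s) s') (unrnd dl z - gr x)) ^+ 2)%:E.
apply: (@le_trans _ _ (iter n exp1 h2 s)).
  apply: expn_le => [s'|w wn].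
    by rewrite lee_fin addr_ge0// mulr_ge0.
  rewrite /h2 drop_size_cat// lee_fin lerD2l -mulrA ler_wpM2l//.
  rewrite /bad_block; case: (leP (enorm _) rho) => /= h.
    by rewrite mulr_ge0 ?sqr_ge0// invr_ge0 ltW.
  rewrite mulrC ler_pdivlMr// mul1r /c.
  have -> : \sum_(z <- w) (unrnd dl z - gr x) = n%:R *: (block_mean w - gr x).
    rewrite big_split /= big_const_seq count_predT iter_addr_0 wn.
    rewrite scalerBr /block_mean scalerA divff ?gt_eqF// scale1r mulNrn.
    by rewrite scaler_nat.
  rewrite enormZ gtr0_norm//; apply: lerXn2r.
  - by rewrite nnegrE mulr_ge0// ltW.
  - by rewrite nnegrE mulr_ge0 ?enorm_ge0// ltW.
  - by rewrite ler_pM2l// ltW.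
have bc : 0 <= b / c by rewrite divr_ge0// ltW.
have := @block_moment s a (b / c) sx a0 bc n [::] (add0n n).
rewrite cats0 big_nil enorm0 => /le_trans; apply.
rewrite lee_fin lerD2l expr0n/= add0r -mulrA ler_wpM2l// mulrC ler_pdivrMr//.
apply: (@le_trans _ _ (expR 1 * (n%:R * (3 * sigma ^+ 2)))).
  apply: ler_wpM2r; last exact: growth_le_exp.
  by apply: mulr_ge0; [exact: ltW|rewrite mulr_ge0 ?sqr_ge0].
have := ler_wpM2l (ltW nR) big_n; rewrite /c;
  move: (expR 1) (sigma ^+ 2) => u v; lra.
Qed.

Definition block (i : nat) (w : seq Z) : seq Z := take n (drop (i * n) w).

Lemma block_cat i (w w' : seq Z) : ((i.+1 * n) <= size w)%N ->
  block i (w ++ w') = block i w.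
Proof.
move=> iw; have inw : (i * n < size w)%N by rewrite (leq_trans _ iw)//
  ltn_pmul2r.
rewrite /block drop_cat inw take_cat; case: ltnP => // h.
have E : size (drop (i * n) w) = n.
  by apply/eqP; rewrite eqn_leq h /= size_drop leq_subRL ?(ltnW inw)// addnC
    -mulSn.
by rewrite E subnn take0 cats0 take_oversize// E.
Qed.

Lemma block_last i (w w' : seq Z) : size w = (i * n)%N -> size w' = n ->
  block i (w ++ w') = w'.
Proof. by move=> wi wn; rewrite /block -wi drop_size_cat// -wn take_size. Qed.

Definition count_bad (rho : R) (k : nat) (w : seq Z) : nat :=
  \sum_(i < k) bad_block rho (block i w).

(* Since [E 9^bad <= 1 + 8/16 = 3/2] for each block, [9^#bad] exceeds [3^m],
  i.e.
   half of the blocks are bad, with probability at most [2^-m]. *)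
Lemma phase_potential (m : nat) (rho : R) (s : seq Z) (a b : R) :
  0 < rho -> 48 * expR 1 * sigma ^+ 2 <= n%:R * rho ^+ 2 ->
  (forall w, (size w < m * n)%N -> q (s ++ w) = x) -> 0 <= a -> 0 <= b ->
  forall j k w, (k + j = m)%N -> size w = (k * n)%N ->
  (iter (j * n) exp1 (fun s' =>
     (a + b * 9 ^+ count_bad rho m (drop (size s) s'))%:E) (s ++ w) <=
   (a + b * (3 / 2) ^+ j * 9 ^+ count_bad rho k w)%:E)%E.
Proof.
move=> rho0 big_n sx a0 b0; elim=> [|j ih] k w kj wk.
  by rewrite mul0n /= drop_size_cat// expr0 mulr1 -kj addn0.
rewrite mulSn iterD.
set B := b * (3 / 2) ^+ j * 9 ^+ count_bad rho k w.
have B0 : 0 <= B by rewrite !mulr_ge0// ?exprn_ge0// divr_ge0.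
pose h2 (s' : seq Z) : \bar R :=
  ((a + B) + (8 * B) * (bad_block rho (drop (size (s ++ w)) s'))%:R)%:E.
apply: (@le_trans _ _ (iter n exp1 h2 (s ++ w))).
  apply: expn_le.
    by apply: expn_ge0 => s'; rewrite lee_fin addr_ge0// mulr_ge0// exprn_ge0.
  move=> w' wn; rewrite -catA; apply: (le_trans (ih k.+1 _ _ _)).
  - by rewrite addSnnS.
  - by rewrite size_cat wk wn mulSnr.
  rewrite /h2 catA drop_size_cat// lee_fin.
  have -> : count_bad rho k.+1 (w ++ w') =
    (count_bad rho k w + bad_block rho w')%N.
    rewrite /count_bad big_ord_recr /= block_last//; congr (_ + _)%N.
    apply: eq_bigr => i _; rewrite block_cat// wk leq_pmul2r//.
  rewrite exprD mulrA -/B -addrA lerD2l.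
  case: bad_block => /=; lra.
apply: (le_trans (block_bad rho0 big_n _ _ _)).
- move=> w' wn; rewrite -catA; apply: sx.
  rewrite size_cat wk -kj mulnDl mulSn ltn_add2l.
  by rewrite (leq_trans wn)// leq_addr.
- exact: addr_ge0.
- by rewrite mulr_ge0.
- rewrite lee_fin /B; move: (9 ^+ _) => u; rewrite [_ ^+ j.+1]exprS.
  by move: (_ ^+ j) => v; lra.
Qed.

End Block.

(* Any point close to more than half of the block means; [gr x] is one when most
   blocks are good, and two majorities share a block. *)
Definition median_mean (n m : nat) (rho : R) (w : seq Z) : V :=
  xget 0 [set z | (m < 2 * \sum_(i < m)
    (enorm (block_mean n (block n i w) - z) <= rho)%R)%N].

Lemma median_mean_error (n m : nat) (rho : R) (w : seq Z) (x : V) :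
  (2 * count_bad n x rho m w < m)%N ->
  enorm (median_mean n m rho w - gr x) <= 2 * rho.
Proof.
move=> few.
have compl : (\sum_(i < m) (enorm (block_mean n (block n i w) - gr x) <= rho)%R
  +
    count_bad n x rho m w = m)%N.
  rewrite /count_bad -big_split /= -[RHS]card_ord -sum1_card.
  by apply: eq_bigr => i _; rewrite /bad_block; case: (_ <= _).
have : (m < 2 * \sum_(i < m)
    (enorm (block_mean n (block n i w) - median_mean n m rho w) <= rho)%R)%N.
  apply: (@xgetPex _ 0 [set z | (m < 2 * \sum_(i < m)
    (enorm (block_mean n (block n i w) - z) <= rho)%R)%N]); exists (gr x).
  by move: compl few; rewrite /mkset;
    move: (count_bad _ _ _ _ _) (\sum_(i < m) _)%N => u v; lia.
move=> many.
have [i /andP[h1 h2]] : exists i : 'I_m,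
    (enorm (block_mean n (block n i w) - gr x) <= rho) &&
    (enorm (block_mean n (block n i w) - median_mean n m rho w) <= rho).
  apply/existsP; apply: contraT; rewrite negb_exists => /forallP none.
  have : (\sum_(i < m) (enorm (block_mean n (block n i w) - gr x) <= rho)%R +
    \sum_(i < m) (enorm (block_mean n (block n i w) - median_mean n m rho w) <=
      rho)%R <= m)%N.
    rewrite -big_split /= -[leqRHS]card_ord -sum1_card; apply: leq_sum => i _.
    by have := none i; case: (_ <= rho); case: (_ <= rho).
  move: compl few many;
    move: (count_bad _ _ _ _ _) (\sum_(i < m) _)%N (\sum_(i < m) _)%N.
  by move=> u v v'; lia.
have -> : median_mean n m rho w - gr x =
  (block_mean n (block n i w) - gr x) - (block_mean n (block n i w) -
    median_mean n m rho w).
  by rewrite opprB [RHS]addrC addrA subrK.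
rewrite (le_trans (ler_enormB _ _))//; lra.
Qed.

Lemma phase_fail (n m : nat) (rho : R) (s : seq Z) (x : V) (a : R) :
  (0 < n)%N -> (n%:R + 2) * (d%:R * dl ^+ 2) <= sigma ^+ 2 ->
  0 < rho -> 48 * expR 1 * sigma ^+ 2 <= n%:R * rho ^+ 2 ->
  (forall w, (size w < m * n)%N -> q (s ++ w) = x) -> 0 <= a ->
  (iter (m * n) exp1 (fun s' => (a +
     (~~ (enorm (median_mean n m rho (drop (size s) s') - gr x) <= 2 *
       rho)%R)%:R)%:E) s
   <= (a + (1 / 2) ^+ m)%:E)%E.
Proof.
move=> n0 ndl rho0 big_n sx a0.
(* The weight [3^-m] makes the potential at least [1] on failure, and its initial bound becomes
   [3^-m * (3 / 2)^m = 2^-m]. *)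
have b0 : 0 <= (1 / 3) ^+ m :> R by rewrite exprn_ge0// divr_ge0.
have := phase_potential n0 ndl rho0 big_n sx a0 b0 (add0n m) (_ : size [::] =
  (0 * n)%N).
move=> /(_ erefl); rewrite cats0 => H.
apply: (@le_trans _ _ _ _ _ (le_trans _ H)).
  apply: expn_le => [s'|w _]; first by rewrite lee_fin addr_ge0.
  rewrite drop_size_cat// lee_fin lerD2l.
  case: (boolP (enorm _ <= _)) => /= [_|bad].
    by rewrite mulr_ge0// exprn_ge0.
  have many : (m <= 2 * count_bad n x rho m w)%N.
    by rewrite leqNgt; apply: contra bad; exact: median_mean_error.
  rewrite (_ : 9 = 3 ^+ 2 :> R); last by ring.
  rewrite -exprM expr_div_n expr1n mul1r ler_pdivlMl ?exprn_gt0// mulr1.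
  by rewrite ler_eXn2l// ltr1n.
rewrite lee_fin lerD2l /count_bad big_ord0 expr0 mulr1 -exprMn.
rewrite (_ : 1 / 3 * (3 / 2) = 1 / 2 :> R)//; by field.
Qed.

(** The point queried throughout phase [j] is read off the transcript of the completed earlier
    phases. *)
Definition phase_bad (n m : nat) (rho : R) (j : nat) (s : seq Z) : bool :=
  ~~ (enorm (median_mean n m rho (take (m * n) (drop (j * (m * n)) s)) -
             gr (q (take (j * (m * n)) s))) <= 2 * rho).

(** Union bound as an expectation: each phase adds at most [2^-m] to the expected number of bad
    phases, whatever happened before. *)
Lemma run_fail (n m : nat) (rho : R) :
  (0 < n)%N -> (0 < m)%N -> (n%:R + 2) * (d%:R * dl ^+ 2) <= sigma ^+ 2 ->
  0 < rho -> 48 * expR 1 * sigma ^+ 2 <= n%:R * rho ^+ 2 ->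
  (forall s w, (m * n %| size s)%N -> (size w < m * n)%N -> q (s ++ w) = q s) ->
  forall j k s, size s = (k * (m * n))%N ->
  (iter (j * (m * n)) exp1 (fun s' =>
     ((\sum_(i < k + j) phase_bad n m rho i s')%:R)%:E) s <=
   ((\sum_(i < k) phase_bad n m rho i s)%:R + j%:R * (1 / 2) ^+ m)%:E)%E.
Proof.
move=> n0 m0 ndl rho0 big_n qs.
have h0 : 0 <= (1 / 2) ^+ m :> R by rewrite exprn_ge0// divr_ge0.
elim=> [|j ih] k s sk.
  by rewrite mul0n /= addn0 mul0r addr0.
rewrite mulSn iterD.
set A : R := (\sum_(i < k) phase_bad n m rho i s)%:R.
have A0 : 0 <= A + j%:R * (1 / 2) ^+ m by rewrite addr_ge0// mulr_ge0.
have sx w : (size w < m * n)%N -> q (s ++ w) = q s.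
  by move=> wn; apply: qs => //; rewrite sk dvdn_mull.
have H := phase_fail n0 ndl rho0 big_n sx A0.
apply: (le_trans _ (le_trans H _)); last first.
  by rewrite lee_fin -[j.+1%:R]natr1; lra.
apply: expn_le => [s'|w wn]; first by apply: expn_ge0 => s''; rewrite lee_fin.
have := ih k.+1 (s ++ w); rewrite size_cat sk wn mulSnr => /(_ erefl).
rewrite addSnnS => /le_trans; apply.
rewrite lee_fin big_ord_recr /= natrD drop_size_cat//.
have -> : phase_bad n m rho k (s ++ w) =
    ~~ (enorm (median_mean n m rho w - gr (q s)) <= 2 * rho).
  have tq : take (k * (m * n)) (s ++ w) = s by apply: take_size_cat.
  have tw : take (m * n) (drop (k * (m * n)) (s ++ w)) = w.
    by rewrite drop_size_cat// take_oversize// wn.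
  by rewrite /phase_bad tq tw.
have -> : (\sum_(i < k) phase_bad n m rho i (s ++ w) =
   \sum_(i < k) phase_bad n m rho i s)%N.
  apply: eq_bigr => i _; rewrite /phase_bad.
  have ik : (i.+1 * (m * n) <= size s)%N by rewrite sk leq_mul2r ltn_ord orbT.
  have -> : take (m * n) (drop (i * (m * n)) (s ++ w)) =
      take (m * n) (drop (i * (m * n)) s).
    by rewrite -!/(block (m * n) i _) block_cat// muln_gt0 m0.
  have lt : (i * (m * n) < size s)%N by rewrite sk ltn_pmul2r ?muln_gt0 ?m0 ?n0.
  by rewrite take_cat lt.
rewrite -/A; lra.
Qed.

End Transcripts.

(** * The algorithm and its parameters *)

Section Algorithm.
Context (R : realType) (d : nat).
Local Notation V := 'rV[R]_d.
Local Notation Z := 'rV[int]_d.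
Variables (Rad eta dl rho : R) (n m : nat).
Local Notation len := (m * n)%N.

(** The integer division discards the unfinished phase, which keeps the query fixed during a
    phase. *)
Definition estimates (s : seq Z) : seq V :=
  [seq median_mean dl n m rho (take len (drop (j * len) s))
     | j <- iota 0 (size s %/ len)].

Definition cp_query (s : seq Z) : V :=
  next_center (2 * Rad) (hist (2 * Rad) (estimates s)).

Definition cp_answer (s : seq Z) : V :=
  cp_output Rad eta (hist (2 * Rad) (estimates s)).

Hypothesis len0 : (0 < len)%N.

Lemma estimates_cat (s w : seq Z) :
  (len %| size s)%N -> (size w < len)%N -> estimates (s ++ w) = estimates s.
Proof.
move=> /dvdnP[k sk] wl; rewrite /estimates size_cat sk.
rewrite (divnMDl _ _ len0) (divn_small wl) addn0 (mulnK _ len0).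
apply/eq_in_map => j; rewrite mem_iota add0n => /= jk; congr median_mean.
by apply: (block_cat len0); rewrite sk leq_mul2r jk orbT.
Qed.

Lemma size_estimates (s : seq Z) : size (estimates s) = (size s %/ len)%N.
Proof. by rewrite size_map size_iota. Qed.

Lemma nth_estimates (s : seq Z) k : (k < size s %/ len)%N ->
  nth 0 (estimates s) k = median_mean dl n m rho (take len (drop (k * len) s)).
Proof.
move=> kl; rewrite (nth_map 0%N); last by rewrite size_iota.
by rewrite (nth_iota _ _ kl) add0n.
Qed.

Lemma estimates_take (s : seq Z) k : (k <= size s %/ len)%N ->
  take k (estimates s) = estimates (take (k * len) s).
Proof.
move=> kl; have ks : (k * len <= size s)%N by rewrite -leq_divRL.
rewrite /estimates -map_take take_iota (minn_idPl kl).
rewrite size_take_min (minn_idPl ks) (mulnK _ len0).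
apply/eq_in_map => j; rewrite mem_iota add0n => /= jk; congr median_mean.
rewrite -{1}(cat_take_drop (k * len) s).
have jl : (j.+1 * len <= size (take (k * len) s))%N.
  by rewrite size_take_min (minn_idPl ks) leq_mul2r jk orbT.
have := block_cat len0 (drop (k * len) s) jl; rewrite /block => ->.
by [].
Qed.

Lemma cp_answer_optimal (f : V -> R) (L eps r : R) (T : nat) (s : seq Z) :
  sco_objective L Rad f -> 0 <= L -> 0 < r -> r <= Rad -> 0 < eta -> 0 < rho ->
  r * (L + 2 * rho) <= eta -> 2 * eta + 3 * Rad * (2 * rho) <= eps ->
  (1 - gain R) ^+ T * (2 * Rad) ^+ d < r ^+ d ->
  size s = (T * len)%N ->
  (forall j, (j < T)%N -> ~~ phase_bad (grad f) dl cp_query n m rho j s) ->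
  eps_optimal f eps (cp_answer s).
Proof.
move=> sco L0 r0 rRad eta0 rho0 rL epsE vol sT good.
have sl : (size s %/ len)%N = T by rewrite sT mulnK.
have nu0 : 0 < 2 * rho by rewrite mulr_gt0.
apply: (cutting_plane_optimal sco L0 r0 rRad eta0 nu0 rL epsE).
  by rewrite size_estimates sl.
move=> k; rewrite size_estimates => kl.
rewrite nth_estimates// estimates_take; last exact: ltnW.
rewrite sl in kl; have := good k kl; rewrite /phase_bad negbK.
by [].
Qed.

Lemma nat_measurable (disp : measure_display) (U : measurableType disp)
  (h : nat -> U) : measurable_fun setT h.
Proof. by []. Qed.

Hypothesis dl0 : 0 < dl.

Definition cp_algorithm : algorithm R d :=
  @nat_algorithm R d (fun k => cp_query (transcript d k)) (record dl)
    (fun k => cp_answer (transcript d k)) (pickle ([::] : seq Z))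
    (@nat_measurable _ _ _) (measurable_record dl0) (@nat_measurable _ _ _).

Lemma iter_nat_step (orc : R.-pker (borel_rV R d) ~> (borel_rV R d))
    (h : seq Z -> \bar R) (N k : nat) :
  iter N (nat_step (fun k => cp_query (transcript d k)) (record dl) orc)
    (fun k => h (transcript d k)) k =
  iter N (exp1 orc dl cp_query) h (transcript d k).
Proof.
elim: N k => // N ih k; rewrite !iterS /nat_step /exp1.
by apply: eq_integral => y _; rewrite -/(nat_step _ _ _) ih /record transcriptK.
Qed.

(** Failure requires a bad phase, so its indicator is at most the number of bad phases, whose
    expectation is at most [T * 2^-m <= 1 / 3]. *)
Lemma cp_algorithm_success (sigma L eps r : R) (T : nat)
    (f : V -> R) (orc : R.-pker (borel_rV R d) ~> (borel_rV R d)) :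
  sco_objective L Rad f -> is_VSGO sigma f orc ->
  0 <= L -> 0 < r -> r <= Rad -> 0 < eta -> 0 < rho ->
  r * (L + 2 * rho) <= eta -> 2 * eta + 3 * Rad * (2 * rho) <= eps ->
  (1 - gain R) ^+ T * (2 * Rad) ^+ d < r ^+ d ->
  (n%:R + 2) * (d%:R * dl ^+ 2) <= sigma ^+ 2 ->
  48 * expR 1 * sigma ^+ 2 <= n%:R * rho ^+ 2 ->
  T%:R * (1 / 2) ^+ m <= 1 / 3 :> R ->
  ((2 / 3)%:E <= mem_law cp_algorithm orc (T * len)
     [set k | eps_optimal f eps (output (a := cp_algorithm) k)])%E.
Proof.
move=> sco [mom1 mom2] L0 r0 rRad eta0 rho0 rL epsE vol ndl big_n Tm.
have [m0 n0] : (0 < m)%N /\ (0 < n)%N by move: len0; rewrite muln_gt0 => /andP.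
set E := [set k | _].
have mE : measurable (E : set nat) by [].
set P := mem_law cp_algorithm orc (T * len).
pose h (s : seq Z) : \bar R := (~~ `[< eps_optimal f eps (cp_answer s)
  >])%:R%:E.
have PE : P (~` E) = (\int[P]_k h (transcript d k))%E.
  rewrite -[~` E]setIT -integral_indic//.
  apply: eq_integral => k _; rewrite indicE /h; congr (_%:R%:E).
  by rewrite in_setC; congr (~~ _); apply/idP/idP; rewrite inE => /asboolP.
have PC : (P (~` E) <= (1 / 3)%:E)%E.
  rewrite PE integral_mem_law => [|k]; last by rewrite lee_fin.
  rewrite iter_nat_step transcriptK.
  have qs (s w : seq Z) : (len %| size s)%N -> (size w < len)%N ->
      cp_query (s ++ w) = cp_query s.
    by move=> ls wl; rewrite /cp_query estimates_cat.
  have := @run_fail R d orc (grad f) sigma dl cp_query mom1 mom2 dl0 n m rho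
    n0 m0 ndl rho0 big_n qs T 0 [::] erefl.
  rewrite big_ord0 add0r => H.
  apply: (@le_trans _ _ (T%:R * (1 / 2) ^+ m)%:E); last by rewrite lee_fin.
  apply: le_trans H; apply: expn_le => // [s|w wT]; first by rewrite lee_fin.
  rewrite /h lee_fin ler_nat add0n /=.
  case: asboolP => //= nopt.
  rewrite lt0n sum_nat_eq0; apply: contra_notN nopt => /forallP good.
  apply: (cp_answer_optimal sco L0 r0 rRad eta0 rho0 rL epsE vol wT) => j jT.
  by have := good (Ordinal jT); rewrite implyTb eqb0.
have -> : P E = (1 - P (~` E))%E by rewrite -probability_setC// setCK.
have : (1%:E - (1 / 3)%:E <= 1 - P (~` E))%E by apply: leeB.
apply: le_trans; rewrite -EFinB lee_fin; lra.
Qed.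

End Algorithm.

(** * Choice of the parameters and number of queries *)

Lemma truncn_succ (R : realType) (x : R) : 0 <= x ->
  x < (Num.trunc x).+1%:R /\ (Num.trunc x).+1%:R <= x + 1.
Proof.
move=> x0; split; first exact: truncnS_gt.
by rewrite -natr1 lerD2r truncn_le.
Qed.

(** [Q] stands for the ratio of the search radius to [r]. Any [T] above [d * ln Q / gain R] suffices
    because [1 - gain R <= expR (- gain R)]; the term [1 / ln 2] of the constant pays for rounding
    [T] up. *)
Lemma phase_count (R : realType) : exists C1 : R, 0 <= C1 /\
  forall (X : R) (d : nat) (Q : R),
    3 <= X -> (0 < d)%N -> 1 < Q -> Q <= X ^+ 7 ->
  exists T : nat, [/\ (0 < T)%N, T%:R <= C1 * d%:R * ln X &
    (1 - gain R) ^+ T * Q ^+ d < 1].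
Proof.
have g0 := gain_gt0 R; have g1 := gain_lt1 R.
have l20 : 0 < ln 2 :> R by rewrite ln_gt0// ltr1n.
exists (7 / gain R + 1 / ln 2); split.
  by rewrite addr_ge0// divr_ge0// ltW.
move=> X d Q X3 d0 Q1 QX.
have X0 : 0 < X by lra.
have Q0 : 0 < Q by lra.
have lQ0 : 0 < ln Q by rewrite ln_gt0.
have lQ : ln Q <= 7 * ln X.
  rewrite mulr_natl -lnXn// ler_ln ?posrE// exprn_gt0//.
have lX : ln 2 <= ln X by rewrite ler_ln ?posrE//; lra.
have dR : 1 <= d%:R :> R by rewrite ler1n.
pose y := d%:R * ln Q / gain R.
have y0 : 0 <= y by rewrite divr_ge0 ?mulr_ge0// ltW.
have [h1 h2] := truncn_succ y0.
exists (Num.trunc y).+1; split => //.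
  apply: (le_trans h2).
  have -> : (7 / gain R + 1 / ln 2) * d%:R * ln X =
    d%:R * (7 * ln X) / gain R + d%:R * (ln X / ln 2).
    by field; rewrite !gt_eqF.
  apply: lerD.
    by rewrite /y ler_pM2r ?invr_gt0// ler_wpM2l// (le_trans _ dR).
  apply: (@le_trans _ _ (1 * 1)); first by rewrite mulr1.
  by apply: ler_pM => //; rewrite ler_pdivlMr// mul1r.
set T := (Num.trunc y).+1 in h1 *.
apply: (@le_lt_trans _ _ (expR (- gain R) ^+ T * expR (ln Q) ^+ d)).
  rewrite lnK ?posrE//; apply: ler_wpM2r; first exact: exprn_ge0 (ltW Q0).
  by rewrite lerXn2r ?nnegrE ?expR_ge0 ?subr_ge0 ?(ltW g1)// expR_ge1Dx.
rewrite -!expRM_natl -expRD -[ltRHS]expR0 ltr_expR.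
move: h1; rewrite /y ltr_pdivrMr//; lra.
Qed.

(** It suffices that [m] exceed the binary logarithm of [3 * T], which is of order [ln X] because
    [T <= C1 * X ^+ 2]. *)
Lemma repetition_count (R : realType) (C1 : R) : 0 <= C1 -> exists C2 : R,
  0 <= C2 /\
  forall (X : R) (d T : nat), 3 <= X -> d%:R <= X -> (0 < T)%N ->
  T%:R <= C1 * d%:R * ln X ->
  exists m : nat, [/\ (0 < m)%N,
    m%:R <= C2 * ln X & T%:R * (1 / 2) ^+ m <= 1 / 3 :> R].
Proof.
move=> C10.
have l20 : 0 < ln 2 :> R by rewrite ln_gt0// ltr1n.
pose c := ln (3 * C1 + 1).
have c0 : 0 <= c by rewrite ln_ge0//; lra.
exists ((c / ln 2 + 2) / ln 2 + 1 / ln 2); split.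
  by rewrite addr_ge0 ?divr_ge0 ?addr_ge0 ?divr_ge0// ltW.
move=> X d T X3 dX T0 TC.
have X0 : 0 < X by lra.
have lX : ln 2 <= ln X by rewrite ler_ln ?posrE//; lra.
have TR : 1 <= T%:R :> R by rewrite ler1n.
have T3 : 0 < 3 * T%:R :> R by lra.
have C3 : 0 < 3 * C1 + 1 by lra.
have X2 : 0 < X ^+ 2 by rewrite exprn_gt0.
have lT : ln (3 * T%:R) <= c + 2 * ln X.
  have -> : c + 2 * ln X = ln ((3 * C1 + 1) * X ^+ 2).
    by rewrite lnM ?posrE// lnXn// mulr_natl.
  have P3 : 0 < (3 * C1 + 1) * X ^+ 2 by rewrite mulr_gt0.
  rewrite ler_ln ?posrE//.
  have : C1 * d%:R * ln X <= C1 * X * X.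
    apply: ler_pM; [by rewrite mulr_ge0|lra|by rewrite ler_wpM2l|].
    by rewrite ltW// ln_sublinear.
  by move: X2; rewrite expr2; lra.
pose y : R := ln (3 * T%:R) / ln 2.
have y0 : 0 <= y by rewrite divr_ge0 ?ln_ge0// ?ltW//; lra.
have [h1 h2] := truncn_succ y0.
exists (Num.trunc y).+1; split => //.
  apply: (le_trans h2).
  have -> : ((c / ln 2 + 2) / ln 2 + 1 / ln 2) * ln X =
    (c * (ln X / ln 2) + 2 * ln X) / ln 2 + ln X / ln 2.
    by field; rewrite gt_eqF.
  have q1 : 1 <= ln X / ln 2 by rewrite ler_pdivlMr// mul1r.
  apply: lerD => //; rewrite /y ler_pM2r ?invr_gt0//.
  apply: (le_trans lT); rewrite lerD2r ler_peMr//.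
set m := (Num.trunc y).+1 in h1 *.
have : 3 * T%:R <= 2 ^+ m :> R.
  have l2m : ln (2 ^+ m) = m%:R * ln 2 :> R by rewrite lnXn// mulr_natl.
  rewrite -ler_ln ?posrE ?exprn_gt0// l2m -ler_pdivrMr//.
  exact: ltW.
have -> : (1 / 2) ^+ m = (2 ^+ m)^-1 :> R by rewrite mul1r exprVn.
have : 0 < 2 ^+ m :> R by rewrite exprn_gt0.
move: (2 ^+ m) => u u0 h; rewrite ler_pdivrMr//; lra.
Qed.

(** The exponent is [4 + 3]: [1 + Rad * L * e <= X ^+ 4], and [16 <= 27 <= X ^+ 3] from [X >= 3]. *)
Lemma domain_ratio_bound (R : realFieldType) (L Rad e d : R) :
  0 <= L -> 0 <= Rad -> 0 < e -> 1 <= d ->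
  16 * (1 + Rad * L * e) <= (2 + e + d + Rad + L) ^+ 7.
Proof.
move=> L0 Rad0 e0 d1; set X := 2 + e + d + Rad + L.
have X3 : 3 <= X by rewrite /X; lra.
have X0 : 0 <= X by lra.
have RX : Rad <= X by rewrite /X; lra.
have LX : L <= X by rewrite /X; lra.
have eX : e <= X by rewrite /X; lra.
have h : Rad * L * e <= X * X * X.
  apply: ler_pM; [exact: mulr_ge0|exact: ltW|exact: ler_pM|exact: eX].
have X27 : 27 <= X ^+ 3.
  rewrite (_ : 27 = 3 ^+ 3); last by ring.
  by rewrite lerXn2r ?nnegrE.
apply: (@le_trans _ _ (27 * (X ^+ 4))).
  apply: ler_pM; rewrite ?addr_ge0 ?mulr_ge0// ?ltW//; first lra.
  have : 3 * X ^+ 3 <= X * X ^+ 3 by apply: ler_wpM2r => //; lra.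
  rewrite -exprS (_ : X * X * X = X ^+ 3) in h *; last by ring.
  lra.
by rewrite (_ : 7 = 3 + 4)%N// exprD ler_wpM2r ?exprn_ge0.
Qed.

(** In both cases the minimizer is [0]. For [d = 0] the query bound is zero, and for [Rad = 0] the
    accuracy [eps / (8 * Rad)] would be meaningless. *)
Lemma trivial_case (R : realType) (d : nat) (L Rad eps : R) :
  0 < eps -> (d == 0)%N || (Rad == 0) ->
  exists A : algorithm R d, forall (f : 'rV[R]_d -> R)
    (orc : R.-pker (borel_rV R d) ~> (borel_rV R d)),
    sco_objective L Rad f ->
    ((2 / 3)%:E <= mem_law A orc 0 [set m | eps_optimal f eps (output m)])%E.
Proof.
move=> eps0 triv.
exists (@nat_algorithm R d (fun=> 0) (record 1) (fun=> 0) 0%N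
  (@nat_measurable _ _ _) (measurable_record ltr01) (@nat_measurable _ _ _)).
move=> f orc [_ _ _ [xs [xsmin xsR]]].
have xs0 : xs = 0.
  case/orP: triv => [/eqP d0|/eqP Rad0].
    by apply/rowP => i; move: (ltn_ord i); rewrite {2}d0.
  by apply/eqP; rewrite -enorm_eq0 eq_le enorm_ge0 andbT -Rad0.
rewrite /= diracE mem_set.
  by rewrite [true%:R](_ : _ = 1)// lee_fin; lra.
rewrite /= /eps_optimal; apply: (@le_trans _ _ (inf (range f))); last first.
  by rewrite lerDl ltW.
apply: lb_le_inf; first by exists (f 0); exists 0.
by move=> _ [y _ <-]; rewrite -xs0.
Qed.

Theorem corollary4 (R : realType) :
  exists (C : R) (k : nat),
    forall (d : nat) (L Rad eps sigma : R),
      0 <= L -> 0 <= Rad -> 0 < eps -> 0 < sigma ->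
    exists (N : nat) (A : algorithm R d),
      N%:R <= C * (d%:R * Rad ^+ 2 * sigma ^+ 2 / eps ^+ 2 + d%:R)
                * ln (2 + eps^-1 + d%:R + Rad + L) ^+ k /\
      forall (f : 'rV[R]_d -> R)
             (orc : R.-pker (borel_rV R d) ~> (borel_rV R d)),
        sco_objective L Rad f -> is_VSGO sigma f orc ->
        ((2 / 3)%:E <= mem_law A orc N [set m | eps_optimal f eps (output
          m)])%E.
Proof.
have [C1 [C10 HT]] := phase_count R.
have [C2 [C20 Hm]] := repetition_count C10.
(* [48 * expR 1] comes from [block_bad], and [64] from squaring the [8] in [rho]. *)
have [K KE] : exists K : R, K = 48 * 64 * expR 1 by eexists.
have K0 : 0 <= K by rewrite KE; have := expR_ge0 (1 : R); lra.
exists (C1 * C2 * (K + 1)), 2 => d L Rad eps sigma L0 Rad0 eps0 sigma0.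
set X := 2 + _ + _ + _ + _.
have e0 : 0 < eps^-1 by rewrite invr_gt0.
have X1 : 1 <= X by have := ler0n R d; rewrite /X; lra.
have lX0 : 0 <= ln X by rewrite ln_ge0.
have W0 : 0 <= Rad ^+ 2 * sigma ^+ 2 / eps ^+ 2.
  by apply: divr_ge0; [apply: mulr_ge0|]; exact: sqr_ge0.
have [triv|] := boolP ((d == 0)%N || (Rad == 0)).
  have [A HA] := trivial_case L eps0 triv.
  exists 0%N, A; split; last by move=> f orc sco _; exact: HA.
  apply: mulr_ge0; last exact: exprn_ge0.
  apply: mulr_ge0; first by apply: mulr_ge0; [exact: mulr_ge0|rewrite addr_ge0].
  apply: addr_ge0; last exact: ler0n.
  have := mulr_ge0 (ler0n R d) W0.
  by rewrite !mulrA.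
rewrite negb_or -lt0n => /andP[d0 Radn0].
have {Radn0}RadP : 0 < Rad by rewrite lt_def Radn0.
have dR : 1 <= d%:R :> R by rewrite ler1n.
have X3 : 3 <= X by rewrite /X; lra.
have dX : d%:R <= X by rewrite /X; lra.
(* This is [2 * Rad / r] for the radius [r] chosen below. *)
pose Q := 16 * (1 + Rad * L * eps^-1).
have Le0 : 0 <= Rad * L * eps^-1 by rewrite !mulr_ge0// ltW.
have Q1 : 1 < Q by rewrite /Q; lra.
have [T [T0 TC vol]] := HT X d Q X3 d0 Q1 (domain_ratio_bound L0 Rad0 e0 dR).
have [m [m0 mC Tm]] := Hm X d T X3 dX T0 TC.
pose W := Rad ^+ 2 * sigma ^+ 2 / eps ^+ 2.
have KW0 : 0 <= K * W by rewrite mulr_ge0.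
have [n1 n2] := truncn_succ KW0.
set n := (Num.trunc (K * W)).+1 in n1 n2.
have n0 : (0 < n)%N by [].
(* Error budget: [2 * (eps / 8)] from the certificate and [3 * Rad * (2 * rho) = 3 / 4 * eps] from
   the estimates add up to [eps]. *)
pose rho := eps / (8 * Rad).
(* Chosen so that [r * (L + 2 * rho) <= eps / 8] and [r <= Rad], including when [L = 0]. *)
pose r := Rad * eps / (8 * (Rad * L + eps)).
have D0 : 0 < Rad * L + eps by rewrite ltr_wpDl// mulr_ge0.
pose dl := sigma / ((n%:R + 2) * d%:R).
have nd0 : 0 < (n%:R + 2) * d%:R :> R.
  by rewrite mulr_gt0 ?ltr0n// addr_gt0// ltr0n.
have dl0 : 0 < dl by rewrite divr_gt0.
exists (T * (m * n))%N, (@cp_algorithm R d Rad (eps / 8) dl rho n m dl0); split.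
  rewrite !natrM.
  (* The three groups bound [T], [m] and [n]; the two logarithms come from the number of cuts and
     the number of repetitions. *)
  have -> : C1 * C2 * (K + 1) * (d%:R * Rad ^+ 2 * sigma ^+ 2 / eps ^+ 2 +
    d%:R) *
      ln X ^+ 2 = (C1 * d%:R * ln X) * ((C2 * ln X) * ((K + 1) * (W + 1))).
    by rewrite /W; field; rewrite gt_eqF.
  apply: ler_pM => //.
  apply: ler_pM => //; apply: (le_trans n2).
  by rewrite mulrDl mulrDr mulr1 mul1r; have : 0 <= W by []; lra.
move=> f orc sco vsgo.
apply: (@cp_algorithm_success _ _ _ _ _ _ _ _ _ _ sigma L eps r) => //.
- by rewrite muln_gt0 m0.
- by rewrite divr_gt0 ?mulr_gt0.
- rewrite ler_pdivrMr ?mulr_gt0// ler_pM2l//.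
  have : 0 <= Rad * L by rewrite mulr_ge0.
  lra.
- by rewrite divr_gt0.
- by rewrite divr_gt0// mulr_gt0.
- have -> : r * (L + 2 * rho) =
  (eps / 8) * ((Rad * L + eps / 4) / (Rad * L + eps)).
    by rewrite /r /rho; field; rewrite !gt_eqF.
  apply: ler_piMr; first by rewrite divr_ge0// ltW.
  by rewrite ler_pdivrMr//; lra.
- have -> : 2 * (eps / 8) + 3 * Rad * (2 * rho) = eps.
    by rewrite /rho; field; rewrite gt_eqF.
  by [].
- have r0 : 0 < r by rewrite divr_gt0 ?mulr_gt0.
  have -> : 2 * Rad = Q * r.
    by rewrite /Q /r; field; rewrite !gt_eqF.
  by rewrite exprMn mulrA gtr_pMl ?exprn_gt0.
- have -> : (n%:R + 2) * (d%:R * dl ^+ 2) = sigma ^+ 2 / ((n%:R + 2) * d%:R).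
    have dp : 0 < d%:R :> R by rewrite ltr0n.
    have np : 0 < n%:R + 2 :> R by rewrite addr_gt0// ltr0n.
    by rewrite /dl; field; rewrite !gt_eqF.
  rewrite ler_pdivrMr// ler_peMr ?sqr_ge0//.
  have : 1 <= n%:R :> R by rewrite ler1n.
  by move: (n%:R : R) (d%:R : R) dR => u v v1 u1; nra.
- have -> : n%:R * rho ^+ 2 = n%:R * (eps ^+ 2 / (64 * Rad ^+ 2)).
    by rewrite /rho; field; rewrite gt_eqF.
  have -> : 48 * expR 1 * sigma ^+ 2 = K * W * (eps ^+ 2 / (64 * Rad ^+ 2)).
    by rewrite KE /W; field; rewrite !gt_eqF.
  by rewrite ler_pM2r ?ltW// divr_gt0 ?mulr_gt0 ?exprn_gt0.
Qed.
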